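(* Assume (A1) and (A2). Let $\bar Z\in\mathcal{Z}_\star$ and $\bar H\in\mathcal{C}(\bar Z)$. Then for every $\tilde W^{(0)}\in\mathbb{S}^n$, the sequence $$\tilde W^{(k+1)}:=\mathcal{P}^\perp\Theta_{\bar H}(\tilde W^{(k)})+\mathcal{P}\Theta^\perp_{\bar H}(\tilde W^{(k)})+\Psi$$ satisfies $$\lim_{k\to\infty}\big(\tilde W^{(k+1)}-\tilde W^{(k)}\big)=\Psi-\Pi_{\mathcal{K}}(\Psi)=\Pi_{\mathcal{K}^\circ}(\Psi),$$ where $\mathcal{K}$ and its polar cone $$\mathcal{K}^\circ=\{Y\in\mathbb{S}^n:\langle\mathcal{P}\Theta_{\bar H}(V)+\mathcal{P}^\perp\Theta^\perp_{\bar H}(V),Y\rangle\le0\ \ \forall V\in\mathbb{S}^n\}$$ are closed convex cones.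
   Context: Notation: $\mathbb{S}^n$ is the space of real symmetric $n\times n$ matrices with $\langle A,B\rangle=\mathrm{tr}(AB)$. $\Pi_+$, $\Pi_-$ are the orthogonal projections onto the PSD and NSD cones. For $F\in\{\Pi_+,\Pi_-\}$: $$F'(Z;H):=\lim_{t\downarrow0}\frac{F(Z+tH)-F(Z)}{t},\qquad F''(Z;H,W):=\lim_{t\downarrow0}\frac{F(Z+tH+\tfrac{t^2}{2}W)-F(Z)-tF'(Z;H)}{t^2/2}.$$ SDP data $C,A_1,\dots,A_m\in\mathbb{S}^n$, $b\in\mathbb{R}^m$ define $\mathcal{A}X:=(\langle A_i,X\rangle)_i$ and $\mathcal{A}^*y:=\sum_iy_iA_i$. A KKT point is $(X,y,S)$ with $\mathcal{A}X=b$, $\mathcal{A}^*y+S=C$, $X,S\succeq0$, $\langle X,S\rangle=0$. $\mathcal{X}_\star$, $\mathcal{S}_\star$ are the sets of $X$, resp. $S$, in KKT points. (A1) $\mathcal{A}$ is surjective. (A2) Some KKT point $(X_{sc},y_{sc},S_{sc})$ has $\mathrm{rank}X_{sc}+\mathrm{rank}S_{sc}=n$. Let $\mathcal{P}:=\mathcal{A}^*(\mathcal{A}\mathcal{A}^* )^{-1}\mathcal{A}$ and $\mathcal{P}^\perp:=\mathrm{Id}-\mathcal{P}$. Fix $\sigma>0$ and let $\mathcal{Z}_\star:=\{X-\sigma S:X\in\mathcal{X}_\star,S\in\mathcal{S}_\star\}$. For $\bar Z\in\mathcal{Z}_\star$: $$\delta'(\bar Z;H):=-\mathcal{P}\Pi_+'(\bar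 Z;H)-\mathcal{P}^\perp\Pi_-'(\bar Z;H),\qquad \delta''(\bar Z;H,W):=-\mathcal{P}\Pi_+''(\bar Z;H,W)-\mathcal{P}^\perp\Pi_-''(\bar Z;H,W),$$ and $\mathcal{C}(\bar Z):=\{H:\delta'(\bar Z;H)=0\}$. Let $P_0$ be the projector onto $\ker\bar Z$ and $\bar Z^\dagger$ the Moore–Penrose pseudoinverse. For $\bar H\in\mathcal{C}(\bar Z)$ let $\Upsilon:=2P_0\bar H\bar Z^\dagger\bar HP_0$ and $$\Theta_{\bar H}(V):=\Pi_+''(\bar Z;\bar H,V+\Upsilon)-\Pi_+''(\bar Z;\bar H,\Upsilon),\qquad \Theta^\perp_{\bar H}(V):=\Pi_-''(\bar Z;\bar H,V+\Upsilon)-\Pi_-''(\bar Z;\bar H,\Upsilon).$$ Let $\Psi:=\delta''(\bar Z;\bar H,\Upsilon)$ and $\mathcal{K}:=\mathrm{cl}\{\mathcal{P}\Theta_{\bar H}(V)+\mathcal{P}^\perp\Theta^\perp_{\bar H}(V):V\in\mathbb{S}^n\}$. *)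

(* Defs.v *)
From HB Require Import structures.
From mathcomp Require Import all_boot all_order all_algebra.
From mathcomp Require Import all_classical all_reals all_analysis.
From Stdlib Require Import ClassicalEpsilon.
Set Implicit Arguments. Unset Strict Implicit. Unset Printing Implicit Defensive.
Import Order.TTheory GRing.Theory Num.Theory.
Import numFieldNormedType.Exports.
Local Open Scope classical_set_scope.
Local Open Scope ring_scope.

Section SDP.
Variable R : realType.
Variable n : nat.
Local Notation mat := 'M[R]_n.

Definition symm (A : mat) : Prop := A^T = A.
Definition Sn : set mat := [set A | symm A].

Definition inner (A B : mat) : R := \tr (A *m B).
Definition fro2 (A : mat) : R := \tr (A^T *m A).

Definition psd (A : mat) : Prop :=
  symm A /\ forall x : 'cV[R]_n, 0 <= (x^T *m A *m x) ord0 ord0.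
Definition nsd (A : mat) : Prop := psd (- A).

(* orthogonal (metric) projection onto a set S: a nearest point of S
   (well defined -- exists and is unique -- when S is nonempty closed convex) *)
Definition mproj (S : set mat) (X : mat) : mat :=
  epsilon (inhabits 0) (fun Y => S Y /\ forall Y', S Y' -> fro2 (X - Y) <= fro2 (X - Y')).

Definition Pplus : mat -> mat := mproj psd.
Definition Pminus : mat -> mat := mproj nsd.

Definition dir1 (F : mat -> mat) (Z H : mat) : mat :=
  lim ((fun t : R => t^-1 *: (F (Z + t *: H) - F Z)) @ 0^'+).

Definition dir2 (F : mat -> mat) (Z H W : mat) : mat :=
  lim ((fun t : R => (t ^+ 2 / 2)^-1 *:
          (F (Z + t *: H + (t ^+ 2 / 2) *: W) - F Z - t *: dir1 F Z H)) @ 0^'+).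

Definition mp_pinv (A : mat) : mat :=
  epsilon (inhabits 0) (fun B => [/\ A *m B *m A = A, B *m A *m B = B,
                                     (A *m B)^T = A *m B & (B *m A)^T = B *m A]).

Definition kerproj (A : mat) : mat :=
  epsilon (inhabits 0) (fun P => [/\ P^T = P, P *m P = P &
                 forall x : 'cV[R]_n, A *m x = 0 <-> P *m x = x]).

Variable m : nat.
Variable Ai : 'I_m -> mat.

Definition opA (X : mat) : 'cV[R]_m := \col_i inner (Ai i) X.
Definition opAadj (y : 'cV[R]_m) : mat := \sum_i y i ord0 *: Ai i.
Definition gramA : 'M[R]_m := \matrix_(i, j) inner (Ai i) (Ai j).
Definition projP (X : mat) : mat := opAadj (invmx gramA *m opA X).
Definition projPperp (X : mat) : mat := X - projP X.

Definition surjA : Prop := forall v : 'cV[R]_m, exists2 X, Sn X & opA X = v.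

Variables (C : mat) (b : 'cV[R]_m).

Definition KKT (X : mat) (y : 'cV[R]_m) (S : mat) : Prop :=
  [/\ opA X = b, opAadj y + S = C, psd X, psd S & inner X S = 0].

Definition Xstar : set mat := [set X | exists y S, KKT X y S].
Definition Sstar : set mat := [set S | exists X y, KKT X y S].

Definition strict_compl : Prop :=
  exists X y S, KKT X y S /\ (\rank X + \rank S = n)%N.

Definition Zstar (sigma : R) : set mat :=
  [set Z | exists X S, [/\ Xstar X, Sstar S & Z = X - sigma *: S]].

Definition delta1 (Z H : mat) : mat :=
  - projP (dir1 Pplus Z H) - projPperp (dir1 Pminus Z H).
Definition delta2 (Z H W : mat) : mat :=
  - projP (dir2 Pplus Z H W) - projPperp (dir2 Pminus Z H W).

Definition critcone (Z : mat) : set mat := [set H | Sn H /\ delta1 Z H = 0].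

Definition Upsilon (Z H : mat) : mat :=
  2%:R *: (kerproj Z *m H *m mp_pinv Z *m H *m kerproj Z).

Definition Theta (Z H V : mat) : mat :=
  dir2 Pplus Z H (V + Upsilon Z H) - dir2 Pplus Z H (Upsilon Z H).
Definition Thetaperp (Z H V : mat) : mat :=
  dir2 Pminus Z H (V + Upsilon Z H) - dir2 Pminus Z H (Upsilon Z H).

Definition Psi (Z H : mat) : mat := delta2 Z H (Upsilon Z H).

Definition Kmap (Z H V : mat) : mat := projP (Theta Z H V) + projPperp (Thetaperp Z H V).

Definition Kcone (Z H : mat) : set mat := closure [set Kmap Z H V | V in Sn].

Definition Kpolar (Z H : mat) : set mat :=
  [set Y | Sn Y /\ forall V, Sn V -> inner (Kmap Z H V) Y <= 0].

Definition iter_step (Z H W : mat) : mat :=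
  projPperp (Theta Z H W) + projP (Thetaperp Z H W) + Psi Z H.

End SDP.

Definition convex_cone (R : realType) (n : nat) (K : set 'M[R]_n) : Prop :=
  [/\ K 0, (forall x y, K x -> K y -> K (x + y)) &
      (forall (a : R) x, 0 <= a -> K x -> K (a *: x))].

(* Main.v *)
(** A semidefinite cone is self-dual, so [X = Pplus X - N] with [Pplus X] and [N]
    psd and orthogonal, which makes [Pplus] firmly nonexpansive.  Diagonalise
    [Z = V L V^T].  A rotation [U = 1 + tA + t^2 B], orthogonal up to [o(t^2)],
    brings [L + th + t^2 w/2] up to [o(t^2)] to a form that is block diagonal
    with respect to the signs of [L]; there [Pplus] keeps the positive block,
    kills the negative one, and on the kernel block is [t Pplus (h0 + t g)].  This
    gives both directional derivatives of [Pplus], and since [g] is half of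
    [E0 (w - Upsilon) E0], it shows that [Theta] is positively homogeneous.  As a
    limit of difference quotients of [Pplus], [Theta] is firmly nonexpansive, and
    hence [M = P Theta + P^perp Theta^perp] is cocoercive.  The iteration reads
    [W - M W + Psi].  The closure [K] of the range of [M] is convex by a resolvent
    argument.  Two orbits of a firmly nonexpansive map have asymptotically equal
    steps; comparing with an orbit started where [M z] is nearly the projection
    of [Psi] on [K], whose steps never get longer, identifies the limit as the
    shortest vector of [Psi - K]. *)
Require Import Defs.
From HB Require Import structures.
From mathcomp Require Import all_boot all_order all_algebra.
From mathcomp Require Import all_classical all_reals all_analysis.
From mathcomp Require complex spectral.
From mathcomp Require Import ring lra.
From Stdlib Require Import ClassicalEpsilon.
Import Order.TTheory GRing.Theory Num.Theory.
Import numFieldNormedType.Exports.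
Set Implicit Arguments. Unset Strict Implicit. Unset Printing Implicit Defensive.
Local Open Scope classical_set_scope.
Local Open Scope ring_scope.

(** * The real spectral theorem *)

Section RealSpectral.
Import complex spectral.
Variable R : realType.

(** Eigenvectors of [Z + t H] need not depend smoothly on [t] where eigenvalues of [Z] coincide, so
    no attempt is made to diagonalise along the path. Only the three sign blocks are separated, and
    this divides only by differences of eigenvalues of different sign. The polynomial rotation is
    not exactly orthogonal. The squared error this causes in the projection is quadratic in the
    defect [E = U^T U - 1], so [E = o(t^2)] gives a squared error [o(t^4)], which is the precision a
    second derivative requires; a bound linear in [E] on the squared error would lose it.

    Derivatives are given by [lim], and projections, kernel projector and pseudoinverse by
    [epsilon]. No formula holds for them before convergence, or existence and uniqueness, is
    established; this is why expansions carry explicit remainders and why each [epsilon] has a lemma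
    identifying its value.

    The range of [M] is not assumed closed, so the projection of [Psi] on its closure is only
    approximated by values [M z]. This is why the final argument works with a tolerance and not with
    a single point [z]. *)

Lemma symm_eigenvalue n (A : 'M[R]_n.+1) : symm A -> exists a, eigenvalue A a.
Proof.
(* Over the complex numbers the matrix is Hermitian, so it has a unitary diagonalisation with real
   eigenvalues; a real root of the characteristic polynomial descends to [R]. *)
move=> As; pose Ac : 'M[R[i]]_n.+1 := map_mx (real_complex R) A.
have Ah : Ac \is hermsymmx.
  apply: realsym_hermsym; last by apply/mxOverP=> i j; rewrite mxE complex_real.
  apply/sesquiP; rewrite expr0 scale1r map_mx_id // /Ac map_trmx.
  by rewrite [A^T]As.
have /mxOverP/(_ ord0 ord0) := hermitian_spectral_diag_real Ah.
have /hermitian_normalmx/orthomx_spectralP := Ah.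
have Pu := spectral_unit Ac.
set P := spectralmx _; set D := spectral_diag _ => AE /complex_realP[a Da].
exists a; rewrite eigenvalue_root_char -(fmorph_root (real_complex R)).
rewrite map_char_poly -eigenvalue_root_char; apply/eigenvalueP.
exists (row ord0 P); last first.
  apply/negP => /eqP P0; have := congr1 (fun M => row ord0 M) (mulmxV Pu).
  rewrite row_mul P0 mul0mx row1 => /matrixP/(_ ord0 ord0).
  by rewrite !mxE !eqxx => /eqP; rewrite eq_sym oner_eq0.
have PA : P *m Ac = diag_mx D *m P by rewrite [in LHS]AE -mulmxA mulKVmx.
rewrite -[map_mx _ _]/Ac -row_mul PA row_mul -[row ord0 (diag_mx D)]/_.
by rewrite row_diag_mx -scalemxAl -rowE Da.
Qed.

(** The Householder reflection along [u = v - e] exchanges the first unit vector [e] and [v]; for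
    [v = e] the identity serves. *)
Lemma orthogonal_first_row n (v : 'rV[R]_n.+1) : (v *m v^T) 0 0 = 1 ->
  exists Q : 'M[R]_n.+1, Q *m Q^T = 1%:M /\ row 0 Q = v.
Proof.
move=> v1; pose e : 'rV[R]_n.+1 := delta_mx 0 0.
have [u uE] : exists u, u = v - e by exists (v - e).
pose s := (u *m u^T) 0 0.
have sE : u *m u^T = s%:M by rewrite [LHS]mx11_scalar.
have e1 : e *m e^T = 1%:M.
  by rewrite /e trmx_delta mul_delta_mx; apply/matrixP=> i j; rewrite !ord1 !mxE.
have vv : v *m v^T = 1%:M by rewrite [LHS]mx11_scalar v1.
pose c := (e *m u^T) 0 0; have cE : e *m u^T = c%:M by rewrite [LHS]mx11_scalar.
have ve : v *m e^T = e *m v^T.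
  by rewrite [LHS]mx11_scalar [RHS]mx11_scalar !mxE; congr (_%:M); apply: eq_bigr => i _; rewrite !mxE mulrC.
have sc : s = - (2 * c).
  have : (u *m u^T) 0 0 = - (2 * (e *m u^T) 0 0).
    rewrite uE linearB /= mulmxBl !mulmxBr vv e1 ve !mxE /=; ring.
  by rewrite sE cE !mxE.
have [s0|s0] := eqVneq s 0.
  exists 1%:M; rewrite trmx1 mulmx1; split=> //; rewrite row1 -/e.
  have u0 : u = 0.
    apply/rowP=> i; rewrite [RHS]mxE; apply/eqP; rewrite -sqrf_eq0 eq_le sqr_ge0 andbT.
    rewrite -s0 /s mxE (bigD1 i)//= mxE expr2 lerDl; apply: sumr_ge0 => j _.
    by rewrite mxE -expr2 sqr_ge0.
  by apply/esym/eqP; rewrite -subr_eq0 -uE u0.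
(* [S] is twice the orthogonal projector onto the line of [u], and [s = - 2 c] turns [e (1 - S)]
   into [e + u = v]. *)
pose S := (2 / s) *: (u^T *m u).
have St : S^T = S by rewrite linearZ /= trmx_mul trmxK.
have SS : S *m S = S + S.
  rewrite -scalemxAl -scalemxAr mulmxA -[u^T *m u *m u^T]mulmxA sE mul_mx_scalar.
  by rewrite -scalemxAl !scalerA -scalerDl; congr (_ *: _); field.
exists (1%:M - S); split.
  rewrite linearB /= trmx1 St mulmxBr mulmx1 mulmxBl mul1mx SS.
  by rewrite opprB addrK subrK.
rewrite rowE -/e mulmxBr mulmx1 -scalemxAr mulmxA cE mul_scalar_mx scalerA.
have -> : 2 / s * c = -1.
  by move: s0; rewrite sc => s0; field; apply/eqP => c0; move: s0; rewrite c0 mulr0 oppr0 eqxx.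
by rewrite scaleN1r opprK uE addrC subrK.
Qed.

(** Deflation: once a unit eigenvector is the first row of [Q], the first row of [Q A Q^T] is a
    multiple of [e], by symmetry so is the first column, and a smaller symmetric block remains. *)
Theorem symm_spectral n (A : 'M[R]_n) : symm A ->
  exists (V : 'M[R]_n) (d : 'rV[R]_n),
    [/\ V^T *m V = 1%:M, V *m V^T = 1%:M & A = V *m diag_mx d *m V^T].
Proof.
elim: n A => [|n IHn] A sA.
  by exists 1%:M, 0; split; apply/matrixP=> -[].
have [a /eigenvalueP[w wA w0]] := symm_eigenvalue sA.
have ww : 0 < (w *m w^T) 0 0.
  have [j wj] : exists j, w 0 j != 0.
    apply/existsP; apply: contraNT w0 => /existsPn h; apply/eqP/rowP => j.
    by rewrite [RHS]mxE; apply/eqP; move: (h j); rewrite negbK.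
  rewrite mxE (bigD1 j)//= mxE -expr2 ltr_pwDl ?exprn_even_gt0//.
  by apply: sumr_ge0 => k _; rewrite mxE -expr2 sqr_ge0.
pose c := Num.sqrt ((w *m w^T) 0 0).
have c2 : c * c = (w *m w^T) 0 0 by rewrite -expr2 sqr_sqrtr// ltW.
have c0 : c != 0 by rewrite gt_eqF// sqrtr_gt0.
have [v [vE v1 vA]] : exists v, [/\ v = c^-1 *: w, (v *m v^T) 0 0 = 1 & v *m A = a *: v].
  exists (c^-1 *: w); split=> //; last by rewrite -scalemxAl wA !scalerA mulrC.
  by rewrite linearZ /= -scalemxAl -scalemxAr scalerA mxE -c2; field.
have [Q [QQ Q0]] := orthogonal_first_row v1.
have QQ' : Q^T *m Q = 1%:M by apply: mulmx1C.
have [M ME] : exists M : 'M[R]_(1 + n), M = Q *m A *m Q^T by exists (Q *m A *m Q^T).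
have sM : M^T = M by rewrite ME !trmx_mul trmxK mulmxA [A^T]sA.
have M0 : row 0 M = a *: delta_mx 0 0.
  by rewrite ME row_mul row_mul Q0 vA -scalemxAl -Q0 -row_mul QQ row1.
have ur : ursubmx M = 0.
  apply/matrixP=> i j; rewrite ord1 !mxE.
  have := congr1 (fun r : 'rV_(1 + n) => r 0 (rshift 1 j)) M0.
  rewrite !mxE => h; rewrite (_ : lshift n 0 = 0) ?h ?andbF ?mulr0 //.
  exact/val_inj.
have dl : dlsubmx M = 0 by rewrite -sM -trmx_ursub ur trmx0.
have [V' [d' [VV VV' MV]]] := IHn (drsubmx M) (etrans (trmx_drsub M) (congr1 drsubmx sM)).
pose V2 : 'M[R]_(1 + n) := block_mx 1%:M 0 0 V'.
have V2t : V2^T = block_mx 1%:M 0 0 V'^T by rewrite tr_block_mx trmx1 !trmx0.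
have V2V2 : V2^T *m V2 = 1%:M.
  by rewrite V2t mulmx_block !mulmx0 !mul0mx !addr0 !add0r VV mulmx1 -scalar_mx_block.
have V2V2' : V2 *m V2^T = 1%:M by apply: mulmx1C.
exists (Q^T *m V2), (row_mx (ulsubmx M) d'); rewrite !trmx_mul trmxK; split.
- by rewrite mulmxA -(mulmxA _ Q) QQ mulmx1.
- by rewrite mulmxA -(mulmxA Q^T) V2V2' mulmx1.
have -> : A = Q^T *m M *m Q.
  by rewrite ME !mulmxA QQ' mul1mx -mulmxA QQ' mulmx1.
have eqM : M = V2 *m diag_mx (row_mx (ulsubmx M) d') *m V2^T.
  rewrite -[LHS](@submxK _ 1 n 1 n) ur dl diag_mx_row V2t /V2 !mulmx_block.
  rewrite !mulmx0 !mul0mx !addr0 !add0r !mul1mx !mulmx1 MV; congr block_mx; last by rewrite mul0mx.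
  by apply/matrixP=> i j; rewrite !ord1 [RHS]mxE eqxx.
by rewrite [in LHS]eqM !mulmxA.
Qed.
End RealSpectral.

(** * The Frobenius product *)

Section FrobeniusProduct.
Variables (R : realType) (n : nat).
Implicit Types A B C : 'M[R]_n.

(** The transpose makes the form positive definite on all matrices, as needed for non-symmetric ones
    such as [P - Q *m P]; it agrees with [inner] when the left argument is symmetric. *)
Definition dotm A B : R := \tr (A^T *m B).

Lemma dotmE A B : dotm A B = \sum_i \sum_j A i j * B i j.
Proof.
rewrite /dotm /mxtrace exchange_big /=; apply: eq_bigr => i _.
by rewrite mxE; apply: eq_bigr => j _; rewrite mxE.
Qed.

Lemma dotmC A B : dotm A B = dotm B A.
Proof. by rewrite !dotmE; do 2!apply: eq_bigr => ? _; rewrite mulrC. Qed.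

Lemma dotmDr C A B : dotm C (A + B) = dotm C A + dotm C B.
Proof. by rewrite /dotm mulmxDr mxtraceD. Qed.
Lemma dotmNr C A : dotm C (- A) = - dotm C A.
Proof. by rewrite /dotm mulmxN linearN. Qed.
Lemma dotmZr a C A : dotm C (a *: A) = a * dotm C A.
Proof. by rewrite /dotm -scalemxAr mxtraceZ. Qed.
Lemma dotm0r C : dotm C 0 = 0.
Proof. by rewrite /dotm mulmx0 mxtrace0. Qed.
Lemma dotmDl C A B : dotm (A + B) C = dotm A C + dotm B C.
Proof. by rewrite !(dotmC _ C) dotmDr. Qed.
Lemma dotmNl C A : dotm (- A) C = - dotm A C.
Proof. by rewrite !(dotmC _ C) dotmNr. Qed.
Lemma dotmZl a C A : dotm (a *: A) C = a * dotm A C.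
Proof. by rewrite !(dotmC _ C) dotmZr. Qed.
Lemma dotm0l C : dotm 0 C = 0.
Proof. by rewrite dotmC dotm0r. Qed.

Definition dotm_expand := (dotmDl, dotmDr, dotmNl, dotmNr, dotmZl, dotmZr).

Lemma dotmM_l C A B : dotm (C *m A) B = dotm A (C^T *m B).
Proof. by rewrite /dotm trmx_mul mulmxA. Qed.
Lemma dotmM_r C A B : dotm (A *m C) B = dotm A (B *m C^T).
Proof. by rewrite /dotm trmx_mul -mulmxA mxtrace_mulC mulmxA. Qed.

Lemma innerE A B : symm A -> inner A B = dotm A B.
Proof. by move=> sA; rewrite /dotm [A^T]sA. Qed.

Lemma fro2E A : fro2 A = dotm A A. Proof. by []. Qed.

Lemma dotm_ge0 A : 0 <= dotm A A.
Proof. by rewrite dotmE; do 2!apply: sumr_ge0 => ? _; rewrite -expr2 sqr_ge0. Qed.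

Lemma entry_le_dotm A i j : A i j ^+ 2 <= dotm A A.
Proof.
rewrite dotmE (bigD1 i)//= (bigD1 j)//= -expr2 -addrA lerDl addr_ge0//.
  by apply: sumr_ge0 => k _; rewrite -expr2 sqr_ge0.
by do 2!apply: sumr_ge0 => ? _; rewrite -expr2 sqr_ge0.
Qed.

Lemma dotm_eq0 A : dotm A A <= 0 -> A = 0.
Proof.
move=> A0; apply/matrixP=> i j; rewrite mxE; apply/eqP; rewrite -sqrf_eq0.
by rewrite eq_le sqr_ge0 andbT (le_trans (entry_le_dotm _ _ _)).
Qed.

Lemma dotm_young s A B : 0 < s -> 2 * dotm A B <= s * dotm A A + s^-1 * dotm B B.
Proof.
move=> s0; have := dotm_ge0 (s *: A - B); rewrite !dotm_expand (dotmC B A) => h.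
rewrite -(ler_pM2l s0) mulrDr mulrA (mulrA s s^-1) divff ?gt_eqF// mul1r; lra.
Qed.

Lemma symmD A B : symm A -> symm B -> symm (A + B).
Proof. by rewrite /symm linearD /= => -> ->. Qed.
Lemma symmN A : symm A -> symm (- A).
Proof. by rewrite /symm linearN /= => ->. Qed.
Lemma symmB A B : symm A -> symm B -> symm (A - B).
Proof. by move=> *; apply: symmD => //; apply: symmN. Qed.
Lemma symmZ a A : symm A -> symm (a *: A).
Proof. by rewrite /symm linearZ /= => ->. Qed.
Lemma symm0 : symm (0 : 'M[R]_n).
Proof. by rewrite /symm linear0. Qed.
Lemma symm_sandwich (N : 'M[R]_n) A : symm A -> symm (N *m A *m N^T).
Proof. by rewrite /symm !trmx_mul trmxK mulmxA => ->. Qed.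
Lemma symm_diag (d : 'rV[R]_n) : symm (diag_mx d).
Proof. exact: tr_diag_mx. Qed.

(** The variational inequality gives [|X - q|^2 >= |X - p|^2 + |p - q|^2], so [p] is the only
    nearest point and [epsilon] must choose it. *)
Lemma mproj_unique (S : set 'M[R]_n) X p : S p ->
  (forall q, S q -> 0 <= dotm (X - p) (p - q)) -> mproj S X = p.
Proof.
move=> Sp hp; rewrite /mproj.
have key q : S q -> fro2 (X - p) + dotm (p - q) (p - q) <= fro2 (X - q).
  move=> /hp h; have -> : X - q = (X - p) + (p - q) by rewrite addrA subrK.
  by move: h; rewrite !fro2E !dotm_expand (dotmC p X) (dotmC q X) (dotmC q p); lra.
have ex : exists Y, S Y /\ forall Y', S Y' -> fro2 (X - Y) <= fro2 (X - Y').
  by exists p; split=> // q /key; apply: le_trans; rewrite lerDl dotm_ge0.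
have [Sq hq] := epsilon_spec (inhabits 0) _ ex.
set q := epsilon _ _ in Sq hq *.
have := hq p Sp; have := key q Sq => h1 h2.
by apply/esym/eqP; rewrite -subr_eq0; apply/eqP/dotm_eq0; lra.
Qed.

Lemma psd_sandwich (N : 'M[R]_n) A : psd A -> psd (N *m A *m N^T).
Proof.
move=> [sA hA]; split; first exact: symm_sandwich.
by move=> x; have := hA (N^T *m x); rewrite trmx_mul trmxK !mulmxA.
Qed.

Lemma psdD A B : psd A -> psd B -> psd (A + B).
Proof.
move=> [sA hA] [sB hB]; split; first exact: symmD.
by move=> x; rewrite mulmxDr mulmxDl mxE addr_ge0.
Qed.

Lemma psdZ a A : 0 <= a -> psd A -> psd (a *: A).
Proof.
move=> a0 [sA hA]; split; first exact: symmZ.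
by move=> x; rewrite -scalemxAr -scalemxAl mxE mulr_ge0.
Qed.

Lemma psd_diag_ge0 A i : psd A -> 0 <= A i i.
Proof.
move=> [_ /(_ (delta_mx i 0))]; rewrite trmx_delta -rowE -colE.
by rewrite !mxE.
Qed.

Lemma quad_formE A (x : 'cV[R]_n) :
  (x^T *m A *m x) 0 0 = \sum_i \sum_j A i j * (x i 0 * x j 0).
Proof.
rewrite mxE exchange_big /=; apply: eq_bigr => j _; rewrite mxE mulr_suml.
by apply: eq_bigr => i _; rewrite !mxE; ring.
Qed.

(** Follows from [|x_i x_j| <= (x_i^2 + x_j^2) / 2]. It serves to keep definite blocks definite
    under small perturbations. *)
Lemma psd_diag_dominant (d : 'rV[R]_n) F : symm F ->
  (forall i, \sum_j `|F i j| <= d 0 i) -> psd (diag_mx d + F).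
Proof.
move=> sF hF; split; first by apply: symmD => //; exact: symm_diag.
move=> x; rewrite mulmxDr mulmxDl mxE !quad_formE.
have -> : \sum_i \sum_j diag_mx d i j * (x i 0 * x j 0) = \sum_i d 0 i * x i 0 ^+ 2.
  apply: eq_bigr => i _; rewrite (bigD1 i)//= big1 ?addr0 ?mxE ?eqxx ?expr2//.
  by move=> j ji; rewrite mxE eq_sym (negbTE ji) mulr0n mul0r.
have aF i j : `|F i j| = `|F j i| by rewrite -{1}sF mxE.
suff : - \sum_i \sum_j F i j * (x i 0 * x j 0) <= \sum_i d 0 i * x i 0 ^+ 2.
  by rewrite lerNl -subr_ge0 opprK addrC.
apply: (@le_trans _ _ (\sum_i \sum_j `|F i j| * ((x i 0 ^+ 2 + x j 0 ^+ 2) / 2))).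
  rewrite -sumrN; apply: ler_sum => i _; rewrite -sumrN; apply: ler_sum => j _.
  rewrite (le_trans (ler_norm _))// normrN normrM ler_wpM2l// ler_norml.
  have := sqr_ge0 (x i 0 - x j 0); have := sqr_ge0 (x i 0 + x j 0).
  by rewrite sqrrD sqrrB => h1 h2; apply/andP; split; lra.
have -> : \sum_i \sum_j `|F i j| * ((x i 0 ^+ 2 + x j 0 ^+ 2) / 2) =
  \sum_i (\sum_j `|F i j|) * x i 0 ^+ 2.
  transitivity (\sum_i \sum_j `|F i j| * x i 0 ^+ 2 / 2 + \sum_i \sum_j `|F i j| * x j 0 ^+ 2 / 2).
    rewrite -big_split; apply: eq_bigr => i _; rewrite -big_split; apply: eq_bigr => j _ /=.
    by rewrite mulrDl mulrDr !mulrA.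
  rewrite [X in _ + X]exchange_big /=.
  rewrite -big_split; apply: eq_bigr => i _; rewrite -big_split mulr_suml.
  by apply: eq_bigr => j _ /=; rewrite (aF j i) -splitr.
by apply: ler_sum => i _; rewrite ler_wpM2r ?sqr_ge0.
Qed.

End FrobeniusProduct.

(** * Projection onto the psd cone *)

Section ConeProjection.
Variables (R : realType) (n : nat).
Implicit Types A B X Y V : 'M[R]_n.

Lemma psd_diag (d : 'rV[R]_n) : (forall i, 0 <= d 0 i) -> psd (diag_mx d).
Proof.
move=> d0; rewrite -[diag_mx d]addr0; apply: psd_diag_dominant.
  exact: symm0.
by move=> i; rewrite big1// => j _; rewrite mxE normr0.
Qed.

(** In an eigenbasis of [A] the product is a sum of eigenvalues of [A] times diagonal entries of the
    conjugated [B]. *)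
Lemma psd_dot_ge0 A B : psd A -> psd B -> 0 <= dotm A B.
Proof.
move=> pA pB; have [V [d [V1 V2 AE]]] := symm_spectral pA.1.
have dE : diag_mx d = V^T *m A *m V^T^T.
  by rewrite AE trmxK !mulmxA V1 mul1mx -mulmxA V1 mulmx1.
have pD : psd (diag_mx d) by rewrite dE; exact: psd_sandwich.
have pB' := psd_sandwich V^T pB.
rewrite AE dotmM_r trmxK dotmM_l mulmxA -[X in _ *m B *m X]trmxK dotmE.
apply: sumr_ge0 => i _; rewrite (bigD1 i)//= big1 ?addr0.
  by apply: mulr_ge0; apply: psd_diag_ge0.
by move=> j ji; rewrite mxE eq_sym (negbTE ji) mulr0n mul0r.
Qed.

(** Moreau's criterion: for psd [q] one has [<Y - X, q - Y> = <Y - X, q> >= 0], which is the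
    variational inequality. *)
Lemma Pplus_unique X Y : psd Y -> psd (Y - X) -> dotm Y (Y - X) = 0 -> Pplus X = Y.
Proof.
move=> pY pYX YX0; apply: mproj_unique => // q pq.
have := psd_dot_ge0 pYX pq; move: YX0; rewrite !dotm_expand (dotmC Y X); lra.
Qed.

Lemma dotm_mulmx0 A B : symm A -> A *m B = 0 -> dotm A B = 0.
Proof. by rewrite /dotm => -> ->; rewrite mxtrace0. Qed.

Lemma Pplus_exists X : symm X -> exists Y, [/\ psd Y, psd (Y - X) & Y *m (Y - X) = 0].
Proof.
move=> sX; have [V [d [V1 V2 XE]]] := symm_spectral sX.
pose p := \row_i Num.max 0 (d 0 i).
exists (V *m diag_mx p *m V^T).
have YX : V *m diag_mx p *m V^T - X = V *m diag_mx (p - d) *m V^T.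
  by rewrite XE linearB /= mulmxBr mulmxBl.
rewrite YX; split.
- by apply/psd_sandwich/psd_diag => i; rewrite mxE le_max lexx.
- by apply/psd_sandwich/psd_diag => i; rewrite !mxE subr_ge0 le_max lexx orbT.
have pd : diag_mx p *m diag_mx (p - d) = 0.
  apply/matrixP => i j; rewrite mul_diag_mx !mxE; case: eqP => [->|_].
    by rewrite mulr1n; case: (leP 0 (d 0 j)) => h; rewrite ?subrr ?mulr0 ?mul0r.
  by rewrite mulr0n mulr0.
rewrite !mulmxA -(mulmxA _ V^T V) V1 mulmx1 -(mulmxA V) pd.
by rewrite mulmx0 mul0mx.
Qed.

(** The matrix product vanishes, not only its trace; both the quadratic error bound and the
    compression lemma depend on this. *)
Lemma Pplus_mul0 X : symm X -> Pplus X *m (Pplus X - X) = 0.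
Proof.
move=> /Pplus_exists[Y [h1 h2 h3]].
by rewrite (Pplus_unique h1 h2 (dotm_mulmx0 h1.1 h3)).
Qed.

Lemma PplusP X : symm X ->
  [/\ psd (Pplus X), psd (Pplus X - X) & dotm (Pplus X) (Pplus X - X) = 0].
Proof.
move=> /Pplus_exists[Y [h1 h2 h3]].
have h := dotm_mulmx0 h1.1 h3.
by rewrite (Pplus_unique h1 h2 h).
Qed.

Lemma Pplus_symm X : symm X -> symm (Pplus X).
Proof. by move=> /PplusP[[]]. Qed.

Lemma Pminus_Pplus X : symm X -> Pminus X = X - Pplus X.
Proof.
move=> /PplusP[pY pYX YX0]; apply: mproj_unique => [|q pq].
  by rewrite /nsd opprB.
have := psd_dot_ge0 pY pq; move: YX0.
rewrite (_ : X - (X - Pplus X) = Pplus X); last by rewrite opprB addrC subrK.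
by rewrite !dotm_expand; lra.
Qed.

(* With [N X = Pplus X - X], this is [<Pplus X, N Y> + <Pplus Y, N X> >= 0]. *)
Lemma Pplus_firm X Y : symm X -> symm Y ->
  dotm (Pplus X - Pplus Y) (Pplus X - Pplus Y) <= dotm (Pplus X - Pplus Y) (X - Y).
Proof.
move=> /PplusP[p1 p2 p3] /PplusP[q1 q2 q3].
have := psd_dot_ge0 p1 q2; have := psd_dot_ge0 q1 p2; move: p3 q3.
by rewrite !dotm_expand (dotmC (Pplus Y) (Pplus X)); lra.
Qed.

Lemma Pplus_nonexp X Y : symm X -> symm Y ->
  dotm (Pplus X - Pplus Y) (Pplus X - Pplus Y) <= dotm (X - Y) (X - Y).
Proof.
move=> sX sY; have := Pplus_firm sX sY.
move: (Pplus X - Pplus Y) (X - Y) => a b h.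
have := dotm_ge0 (a - b); move: h.
by rewrite !dotm_expand (dotmC b a); lra.
Qed.

(** For a splitting [X = Y - (Y - X)] into psd parts that are not quite orthogonal, the defect of
    orthogonality bounds the squared distance of [Y] to the projection. *)
Lemma Pplus_gap X Y : psd Y -> psd (Y - X) -> symm X ->
  dotm (Y - Pplus X) (Y - Pplus X) <= dotm Y (Y - X).
Proof.
move=> pY pYX /PplusP[p1 p2 p3].
have := psd_dot_ge0 pY p2; have := psd_dot_ge0 p1 pYX; move: p3.
by rewrite !dotm_expand (dotmC (Pplus X) Y); lra.
Qed.

Lemma Pplus_conj (V : 'M[R]_n) X : V^T *m V = 1%:M -> symm X ->
  Pplus (V *m X *m V^T) = V *m Pplus X *m V^T.
Proof.
move=> V1 /PplusP[p1 p2 p3].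
have E : V *m Pplus X *m V^T - V *m X *m V^T = V *m (Pplus X - X) *m V^T.
  by rewrite mulmxBr mulmxBl.
apply: Pplus_unique; rewrite ?E; [exact: psd_sandwich..|].
by rewrite dotmM_r trmxK -mulmxA V1 mulmx1 dotmM_l mulmxA V1 mul1mx.
Qed.

(** Since [Y N = N Y = 0], the terms of order zero and one in [E] drop out. *)
Lemma gap_expand (E Y N : 'M[R]_n) : symm E -> symm Y -> symm N -> Y *m N = 0 ->
  dotm ((1%:M + E) *m Y *m (1%:M + E)) N = dotm (E *m Y *m E) N.
Proof.
move=> sE sY sN YN.
have NY : N *m Y = 0 by have := congr1 trmx YN; rewrite trmx_mul trmx0 [Y^T]sY [N^T]sN.
have h1 : dotm Y N = 0 by rewrite /dotm [Y^T]sY YN mxtrace0.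
have h2 : dotm (E *m Y) N = 0 by rewrite dotmM_r [Y^T]sY NY dotm0r.
have h3 : dotm (Y *m E) N = 0 by rewrite dotmM_l [Y^T]sY YN dotm0r.
by rewrite mulmxDl mul1mx mulmxDl !mulmxDr !mulmx1 !dotmDl h1 h2 h3 !add0r.
Qed.

(** Conjugation by any [U] keeps both parts of the decomposition of [D] psd. Only their
    orthogonality is lost, so the gap bound applies. *)
Lemma Pplus_approx_conj (U D : 'M[R]_n) (E := U^T *m U - 1%:M)
    (Y := Pplus D) (Y' := U *m Y *m U^T) : symm D ->
  dotm (Y' - Pplus (U *m D *m U^T)) (Y' - Pplus (U *m D *m U^T)) <=
  dotm (E *m Y *m E) (Y - D).
Proof.
move=> sD; have [pY pYD YD0] := PplusP sD.
have YN := Pplus_mul0 sD; rewrite -/Y in pY pYD YD0 YN.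
have sE : E^T = E by rewrite /E linearB /= trmx_mul trmxK trmx1.
have Y'E : Y' - U *m D *m U^T = U *m (Y - D) *m U^T by rewrite mulmxBr mulmxBl.
have := Pplus_gap (psd_sandwich U pY) _ (symm_sandwich U sD); rewrite -/Y' Y'E.
move=> /(_ (psd_sandwich U pYD)) h; apply: (le_trans h).
have -> : dotm Y' (U *m (Y - D) *m U^T) = dotm ((1%:M + E) *m Y *m (1%:M + E)) (Y - D).
  have -> : 1%:M + E = U^T *m U by rewrite addrC subrK.
  rewrite /Y' -[in LHS](mulmxA U (Y - D)) dotmC dotmM_l.
  rewrite dotmM_r trmxK dotmC; congr dotm; by rewrite !mulmxA.
by rewrite (gap_expand sE pY.1 pYD.1 YN).
Qed.

End ConeProjection.

(** * One-sided expansions *)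

Section MatrixLimits.
Variables (R : realType) (T : Type) (F : set_system T).
Context {FF : Filter F}.

Lemma cvg_sum_fin (I : finType) (f : I -> T -> R) (l : I -> R) :
  (forall i, f i x @[x --> F] --> l i) ->
  (\sum_i f i x) @[x --> F] --> \sum_i l i.
Proof.
move=> fl; elim: (index_enum I) => [|i s IHs].
  by rewrite big_nil; under eq_fun do rewrite big_nil; exact: cvg_cst.
by rewrite big_cons; under eq_fun do rewrite big_cons; exact: cvgD.
Qed.

Lemma mx_cvgP m n (f : T -> 'M[R]_(m, n)) (M : 'M[R]_(m, n)) :
  (forall i j, f x i j @[x --> F] --> M i j) -> f x @[x --> F] --> M.
Proof.
move=> fM A [P MP sPA]; rewrite /nbhs /= /nbhs /=.
have := @filter_forall _ _ _ _ FF (fun i => @filter_forall _ _ _ _ FF (fun j => fM i j _ (MP i j))).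
by apply: filterS => x h; apply: sPA => i j; exact: h.
Qed.

Lemma mx_cvg_entry m n (f : T -> 'M[R]_(m, n)) (M : 'M[R]_(m, n)) i j :
  f x @[x --> F] --> M -> f x i j @[x --> F] --> M i j.
Proof. by move=> fM; exact: (cvg_comp _ _ fM (@coord_continuous _ _ _ i j M)). Qed.

Lemma mulmx_cvg m n p (f : T -> 'M[R]_(m, n)) (g : T -> 'M[R]_(n, p)) (A : 'M[R]_(m, n)) (B : 'M[R]_(n, p)) :
  f x @[x --> F] --> A -> g x @[x --> F] --> B ->
  f x *m g x @[x --> F] --> A *m B.
Proof.
move=> fA gB; apply: mx_cvgP => i j; rewrite mxE; under eq_fun do rewrite mxE.
by apply: cvg_sum_fin => k; apply: cvgM; exact: mx_cvg_entry.
Qed.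

Lemma trmx_cvg m n (f : T -> 'M[R]_(m, n)) (A : 'M[R]_(m, n)) :
  f x @[x --> F] --> A -> (f x)^T @[x --> F] --> A^T.
Proof.
move=> fA; apply: mx_cvgP => i j; rewrite mxE; under eq_fun do rewrite mxE.
exact: mx_cvg_entry.
Qed.

Lemma dotm_cvg n (f g : T -> 'M[R]_n) (A B : 'M[R]_n) :
  f x @[x --> F] --> A -> g x @[x --> F] --> B ->
  dotm (f x) (g x) @[x --> F] --> dotm A B.
Proof.
move=> fA gB; rewrite dotmE; under eq_fun do rewrite dotmE.
by do 2![apply: cvg_sum_fin => ?]; apply: cvgM; exact: mx_cvg_entry.
Qed.

Lemma dotm_cvg0 n (f : T -> 'M[R]_n) (g : T -> R) :
  (\forall x \near F, dotm (f x) (f x) <= g x) ->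
  g x @[x --> F] --> (0 : R) -> f x @[x --> F] --> (0 : 'M[R]_n).
Proof.
move=> fg g0; apply: mx_cvgP => i j; rewrite mxE; apply/cvgr0Pnorm_lt => e e0.
have e2 : 0 < e ^+ 2 by rewrite exprn_gt0.
near=> x; rewrite -(@ltr_pXn2r _ 2)// ?nnegrE// ?ltW//.
rewrite real_normK ?num_real//; apply: le_lt_trans (entry_le_dotm _ _ _) _.
apply: le_lt_trans (_ : g x < _); first by near: x.
by near: x; apply: (cvgr_lt 0).
Unshelve. all: by end_near. Qed.

End MatrixLimits.

Section Jets.
Variables (R : realType).
Implicit Types t : R.

Lemma cvg_id_right0 : t @[t --> 0^'+] --> (0 : R).
Proof. exact: cvg_at_right_filter cvg_id. Qed.

Section JetDef.
Variables (m n : nat).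
Implicit Types f g : R -> 'M[R]_(m, n).

(* [f t = a + t b + o(t)] and [f t = a + t b + t^2 c + o(t^2)] as [t] tends to
   [0] from the right. *)
Definition jet1 f (a b : 'M[R]_(m, n)) := exists r : R -> 'M[R]_(m, n),
  r t @[t --> 0^'+] --> b /\ \forall t \near 0^'+, f t = a + t *: r t.
Definition jet2 f (a b c : 'M[R]_(m, n)) := exists r : R -> 'M[R]_(m, n),
  jet1 r b c /\ \forall t \near 0^'+, f t = a + t *: r t.

Lemma near_jet1 f g a b : (\forall t \near 0^'+, f t = g t) ->
  jet1 f a b -> jet1 g a b.
Proof.
move=> fg [r [rb fr]]; exists r; split=> //.
by near=> t; rewrite -[g t](_ : f t = _); near: t.
Unshelve. all: by end_near. Qed.

Lemma near_jet2 f g a b c : (\forall t \near 0^'+, f t = g t) ->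
  jet2 f a b c -> jet2 g a b c.
Proof.
move=> fg [r [rb fr]]; exists r; split=> //.
by near=> t; rewrite -[g t](_ : f t = _); near: t.
Unshelve. all: by end_near. Qed.

Lemma jet1_shift (r : R -> 'M[R]_(m, n)) b : r t @[t --> 0^'+] --> b -> jet1 (fun t => t *: r t) 0 b.
Proof. by move=> rb; exists r; split=> //; near=> t; rewrite add0r.
Unshelve. all: by end_near. Qed.

Lemma jet1_cst a : jet1 (fun=> a) a 0.
Proof.
exists (fun=> 0); split; first exact: cvg_cst.
by near=> t; rewrite scaler0 addr0.
Unshelve. all: by end_near. Qed.

Lemma jet1_affine a b : jet1 (fun t => a + t *: b) a b.
Proof.
exists (fun=> b); split; first exact: cvg_cst.
by near=> t.
Unshelve. all: by end_near. Qed.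

Lemma jet2_poly a b c : jet2 (fun t => a + t *: b + t ^+ 2 *: c) a b c.
Proof.
exists (fun t => b + t *: c); split; first exact: jet1_affine.
by near=> t; rewrite scalerDr scalerA addrA expr2.
Unshelve. all: by end_near. Qed.

Lemma jet1_cvg f a b : jet1 f a b -> f t @[t --> 0^'+] --> a.
Proof.
move=> [r [rb fr]].
have h : a + t *: r t @[t --> 0^'+] --> a.
  rewrite -[X in _ --> X](_ : a + 0 *: b = a); last by rewrite scale0r addr0.
  by apply: cvgD; [exact: cvg_cst | apply: cvgZ => //; exact: cvg_id_right0].
by apply: cvg_trans h; apply: near_eq_cvg; apply: filterS fr => t ->.
Qed.

Lemma jet2_jet1 f a b c : jet2 f a b c -> jet1 f a b.
Proof. by move=> [r [/jet1_cvg rb fr]]; exists r. Qed.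

Lemma jet1D f g a b a' b' : jet1 f a b -> jet1 g a' b' ->
  jet1 (fun t => f t + g t) (a + a') (b + b').
Proof.
move=> [r [rb fr]] [s [sb gs]]; exists (fun t => r t + s t); split; first exact: cvgD.
near=> t; have -> : f t = a + t *: r t by near: t.
have -> : g t = a' + t *: s t by near: t.
by rewrite scalerDr addrACA.
Unshelve. all: by end_near. Qed.

Lemma jet2D f g a b c a' b' c' : jet2 f a b c -> jet2 g a' b' c' ->
  jet2 (fun t => f t + g t) (a + a') (b + b') (c + c').
Proof.
move=> [r [rb fr]] [s [sb gs]]; exists (fun t => r t + s t); split; first exact: jet1D.
near=> t; have -> : f t = a + t *: r t by near: t.
have -> : g t = a' + t *: s t by near: t.
by rewrite scalerDr addrACA.
Unshelve. all: by end_near. Qed.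

Lemma jet1_quotient f a b : jet1 f a b -> t^-1 *: (f t - a) @[t --> 0^'+] --> b.
Proof.
move=> [r [rb fr]]; apply: cvg_trans rb; apply: near_eq_cvg; near=> t.
have t0 : 0 < t by near: t; exact: nbhs_right_gt.
have -> : f t = a + t *: r t by near: t.
by rewrite addrC addKr scalerA mulVf ?scale1r// gt_eqF.
Unshelve. all: by end_near. Qed.

Lemma jet2_quotient f a b c : jet2 f a b c ->
  (t ^+ 2)^-1 *: (f t - a - t *: b) @[t --> 0^'+] --> c.
Proof.
move=> [r [/jet1_quotient rb fr]]; apply: cvg_trans rb; apply: near_eq_cvg; near=> t.
have t0 : 0 < t by near: t; exact: nbhs_right_gt.
have -> : f t = a + t *: r t by near: t.
rewrite [a + _]addrC addrK -scalerBr scalerA; congr (_ *: _).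
by rewrite expr2 invfM mulfVK ?gt_eqF.
Unshelve. all: by end_near. Qed.

End JetDef.

Lemma jet1_tr m n (f : R -> 'M[R]_(m, n)) a b :
  jet1 f a b -> jet1 (fun t => (f t)^T) a^T b^T.
Proof.
move=> [r [rb fr]]; exists (fun t => (r t)^T); split; first exact: trmx_cvg.
near=> t; have -> : f t = a + t *: r t by near: t.
by rewrite linearD linearZ.
Unshelve. all: by end_near. Qed.

Lemma jet2_tr m n (f : R -> 'M[R]_(m, n)) a b c :
  jet2 f a b c -> jet2 (fun t => (f t)^T) a^T b^T c^T.
Proof.
move=> [r [rb fr]]; exists (fun t => (r t)^T); split; first exact: jet1_tr.
near=> t; have -> : f t = a + t *: r t by near: t.
by rewrite linearD linearZ.
Unshelve. all: by end_near. Qed.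

Lemma jetM_remainder m n p t (a r : 'M[R]_(m, n)) (a' s : 'M[R]_(n, p)) :
  (a + t *: r) *m (a' + t *: s) =
  a *m a' + t *: (a *m s + r *m a' + t *: (r *m s)).
Proof.
rewrite mulmxDl !mulmxDr -!scalemxAl -!scalemxAr !scalerDr.
by rewrite !addrA.
Qed.

Lemma jet1M m n p (f : R -> 'M[R]_(m, n)) (g : R -> 'M[R]_(n, p)) a b a' b' :
  jet1 f a b -> jet1 g a' b' ->
  jet1 (fun t => f t *m g t) (a *m a') (a *m b' + b *m a').
Proof.
move=> [r [rb fr]] [s [sb gs]].
exists (fun t => a *m s t + r t *m a' + t *: (r t *m s t)); split.
  rewrite -[X in _ --> X]addr0 -[X in _ + X](scale0r (b *m b')).
  apply: cvgD; first by apply: cvgD; apply: mulmx_cvg => //; exact: cvg_cst.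
  by apply: cvgZ; [exact: cvg_id_right0 | exact: mulmx_cvg].
near=> t; have -> : f t = a + t *: r t by near: t.
have -> : g t = a' + t *: s t by near: t.
exact: jetM_remainder.
Unshelve. all: by end_near. Qed.

Lemma jet2M m n p (f : R -> 'M[R]_(m, n)) (g : R -> 'M[R]_(n, p)) a b c a' b' c' :
  jet2 f a b c -> jet2 g a' b' c' ->
  jet2 (fun t => f t *m g t) (a *m a') (a *m b' + b *m a')
       (a *m c' + c *m a' + b *m b').
Proof.
move=> [r [rb fr]] [s [sb gs]].
exists (fun t => a *m s t + r t *m a' + t *: (r t *m s t)); split.
  rewrite -[a *m b' + b *m a']addr0; apply: jet1D; last first.
    by apply: jet1_shift; apply: mulmx_cvg; [exact: jet1_cvg rb | exact: jet1_cvg sb].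
  have -> : a *m c' + c *m a' = (a *m c' + 0 *m b') + (b *m 0 + c *m a').
    by rewrite mul0mx mulmx0 addr0 add0r.
  by apply: jet1D; apply: jet1M => //; exact: jet1_cst.
near=> t; have -> : f t = a + t *: r t by near: t.
have -> : g t = a' + t *: s t by near: t.
exact: jetM_remainder.
Unshelve. all: by end_near. Qed.

End Jets.

(** * Expansion of the projection under nearly orthogonal conjugation *)

Section ProjectionJets.
Variables (R : realType) (n : nat).
Implicit Types (t : R) (U D X : R -> 'M[R]_n).

Lemma jet2_of_quotient (f : R -> 'M[R]_n) a b c :
  (t ^+ 2)^-1 *: (f t - a - t *: b) @[t --> 0^'+] --> c -> jet2 f a b c.
Proof.
move=> fc; exists (fun t => b + t *: ((t ^+ 2)^-1 *: (f t - a - t *: b))); split.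
  by exists (fun t => (t ^+ 2)^-1 *: (f t - a - t *: b)); split=> //; near=> t.
near=> t; have t0 : 0 < t by near: t; exact: nbhs_right_gt.
rewrite scalerDr !scalerA -expr2 mulfV ?scale1r ?expf_neq0 ?gt_eqF//.
by rewrite [t *: b + _]addrC subrK addrC subrK.
Unshelve. all: by end_near. Qed.

Lemma Pplus_cvg D d : (forall t, symm (D t)) -> symm d ->
  D t @[t --> 0^'+] --> d -> Pplus (D t) @[t --> 0^'+] --> Pplus d.
Proof.
move=> sD sd Dd.
have h : Pplus (D t) - Pplus d @[t --> 0^'+] --> (0 : 'M[R]_n).
  apply: (@dotm_cvg0 _ _ _ _ _ _ (fun t => dotm (D t - d) (D t - d))).
    by near=> t; exact: Pplus_nonexp.
  have D0 : D t - d @[t --> 0^'+] --> (0 : 'M[R]_n).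
    by rewrite -(subrr d); apply: cvgB => //; exact: cvg_cst.
  rewrite -[X in _ --> X](dotm0l (0 : 'M[R]_n)); exact: dotm_cvg.
rewrite -[Pplus d]add0r; under eq_fun do rewrite -[Pplus _](subrK (Pplus d)).
by apply: cvgD => //; exact: cvg_cst.
Unshelve. all: by end_near. Qed.

(** Two errors of size [o(t^2)] add up: [X] and [U D U^T] have the same expansion and [Pplus] is
    nonexpansive; and [Pplus] commutes with conjugation by [U] up to the quadratic bound. *)
Lemma Pplus_conj_jet U D X d a b c :
  (forall t, symm (D t)) -> (forall t, symm (X t)) -> symm d ->
  jet2 (fun t => (U t)^T *m U t) 1%:M 0 0 ->
  D t @[t --> 0^'+] --> d ->
  jet2 (fun t => U t *m D t *m (U t)^T) a b c -> jet2 X a b c ->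
  jet2 (fun t => Pplus (X t) - U t *m Pplus (D t) *m (U t)^T) 0 0 0.
Proof.
move=> sD sX sd jU Dd jD jX; apply: jet2_of_quotient.
pose Y t := U t *m D t *m (U t)^T.
have sY t : symm (Y t) by exact: symm_sandwich.
pose Q t := (t ^+ 2)^-1.
have e0 : Q t *: (X t - Y t) @[t --> 0^'+] --> (0 : 'M[R]_n).
  rewrite -(subrr c); under eq_fun => t.
    have -> : Q t *: (X t - Y t) = Q t *: (X t - a - t *: b) - Q t *: (Y t - a - t *: b).
      by rewrite -scalerBr opprB addrA subrK opprB addrA subrK.
    over.
  by apply: cvgB; exact: jet2_quotient.
have E0 : Q t *: ((U t)^T *m U t - 1%:M) @[t --> 0^'+] --> (0 : 'M[R]_n).
  have := jet2_quotient jU; apply: cvg_trans; apply: near_eq_cvg; near=> t.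
  by rewrite scaler0 subr0.
have PD := Pplus_cvg sD sd Dd.
have h1 : Q t *: (Pplus (X t) - Pplus (Y t)) @[t --> 0^'+] --> (0 : 'M[R]_n).
  apply: (dotm_cvg0 _ (_ : dotm (Q t *: (X t - Y t)) (Q t *: (X t - Y t)) @[t --> 0^'+] --> 0)).
    near=> t; rewrite !dotmZl !dotmZr !mulrA ler_wpM2l ?Pplus_nonexp//.
    by rewrite -expr2 sqr_ge0.
  by rewrite -[X in _ --> X](dotm0l (0 : 'M[R]_n)); exact: dotm_cvg.
have h2 : Q t *: (U t *m Pplus (D t) *m (U t)^T - Pplus (Y t)) @[t --> 0^'+] --> (0 : 'M[R]_n).
  pose e t := Q t *: ((U t)^T *m U t - 1%:M).
  apply: (dotm_cvg0 _ (_ : dotm (e t *m Pplus (D t) *m e t) (Pplus (D t) - D t) @[t --> 0^'+] --> 0)).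
    near=> t; rewrite /e !dotmZl !dotmZr -!scalemxAl -!scalemxAr !dotmZl.
    rewrite !mulrA ler_wpM2l -?expr2 ?sqr_ge0//.
    exact: Pplus_approx_conj.
  rewrite -[X in _ --> X](dotm0l (Pplus d - d)); apply: dotm_cvg; last exact: cvgB.
  have z0 : 0 *m Pplus d *m 0 = 0 :> 'M[R]_n by rewrite mulmx0.
  by rewrite -[X in _ --> X]z0; exact: (mulmx_cvg (mulmx_cvg E0 PD) E0).
rewrite -[X in _ --> X](subrr (0 : 'M[R]_n)); under eq_fun => t.
  have -> : (t ^+ 2)^-1 *: (Pplus (X t) - U t *m Pplus (D t) *m (U t)^T - 0 - t *: 0) =
    Q t *: (Pplus (X t) - Pplus (Y t)) - Q t *: (U t *m Pplus (D t) *m (U t)^T - Pplus (Y t)).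
    by rewrite scaler0 !subr0 -scalerBr opprB addrA subrK.
  over.
exact: cvgB.
Unshelve. all: by end_near. Qed.

(** With [P = Pplus N'], the product [P P = N' P] is killed by [1 - Q] on the left, so the squared
    norm of [(1 - Q) P], a trace of [(1 - Q) P P (1 - Q)], is zero. *)
Lemma Pplus_compress (Q N : 'M[R]_n) : symm Q -> Q *m Q = Q -> symm N ->
  Q *m Pplus (Q *m N *m Q) *m Q = Pplus (Q *m N *m Q).
Proof.
move=> sQ QQ sN; set N' := Q *m N *m Q; set P := Pplus N'.
have sN' : symm N' by rewrite /symm !trmx_mul [Q^T]sQ [N^T]sN mulmxA.
have [[sP _] _ _] := PplusP sN'.
have PP : P *m P = N' *m P.
  have : P *m P = P *m N' by apply/eqP; rewrite -subr_eq0 -mulmxBr Pplus_mul0.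
  by move=> /(congr1 trmx); rewrite (trmx_mul P P) (trmx_mul P N') [P^T]sP [N'^T]sN'.
have QN : (1%:M - Q) *m N' = 0 by rewrite mulmxBl mul1mx !mulmxA QQ subrr.
have QP : Q *m P = P.
  apply/eqP; rewrite eq_sym -subr_eq0; apply/eqP/dotm_eq0.
  have -> : P - Q *m P = (1%:M - Q) *m P by rewrite mulmxBl mul1mx.
  rewrite /dotm mxtrace_mulC trmx_mul [P^T]sP mulmxA -(mulmxA _ P P) PP.
  by rewrite (mulmxA _ N') QN !mul0mx mxtrace0.
have PQ : P *m Q = P by have := congr1 trmx QP; rewrite trmx_mul [P^T]sP [Q^T]sQ.
by rewrite QP PQ.
Qed.
End ProjectionJets.

(** * Blocks by the sign of the eigenvalues *)

Section SignBlocks.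
Variables (R : realType) (n : nat) (l : 'rV[R]_n).
Implicit Types M N : 'M[R]_n.

Let s i : R := Num.sg (l 0 i).
Let L := diag_mx l.

(* Indices are grouped by the sign of [l]: [blk M] is the block diagonal
   part of [M], and [adinv M] solves [A L - L A = M - blk M] for [A]. *)
Definition blk M : 'M[R]_n := \matrix_(i, j) if s i == s j then M i j else 0.
Definition adinv M : 'M[R]_n :=
  \matrix_(i, j) if s i == s j then 0 else M i j / (l 0 j - l 0 i).
Definition sgE (c : R) : 'M[R]_n := diag_mx (\row_i (s i == c)%:R).

(** Equal eigenvalues have equal signs, so the denominators are nonzero off the blocks. *)
Lemma adinvP M : adinv M *m L - L *m adinv M + blk M = M.
Proof.
apply/matrixP=> i j; rewrite mul_mx_diag mul_diag_mx !mxE.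
case: eqP => [_|/eqP sij]; first by rewrite mul0r mulr0 subrr add0r.
have lij : l 0 j - l 0 i != 0.
  by apply: contraNneq sij => /eqP; rewrite subr_eq0 /s => /eqP ->.
by rewrite addr0; field.
Qed.

(** Skewness makes [1 + tA] orthogonal to first order. *)
Lemma adinv_tr M : symm M -> (adinv M)^T = - adinv M.
Proof.
move=> sM; apply/matrixP=> i j; rewrite !mxE eq_sym; case: ifP => _; first by rewrite oppr0.
by rewrite -{1}[M]sM mxE -mulrN -invrN opprB.
Qed.

Lemma blk_symm M : symm M -> symm (blk M).
Proof.
move=> sM; apply/matrixP=> i j; rewrite !mxE eq_sym; case: ifP => // _.
by rewrite -{1}[M]sM mxE.
Qed.

Lemma adinvD M N : adinv (M + N) = adinv M + adinv N.
Proof.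
by apply/matrixP=> i j; rewrite !mxE; case: ifP => _; rewrite ?addr0// mulrDl.
Qed.
Lemma adinvZ a M : adinv (a *: M) = a *: adinv M.
Proof.
by apply/matrixP=> i j; rewrite !mxE; case: ifP => _; rewrite ?mulr0// mulrA.
Qed.

Lemma sgE_symm c : symm (sgE c).
Proof. exact: symm_diag. Qed.

Lemma sgE_sandwich c c' M i j :
  (sgE c *m M *m sgE c') i j = (s i == c)%:R * M i j * (s j == c')%:R.
Proof. by rewrite mul_mx_diag mul_diag_mx !mxE. Qed.

Lemma sgE_mul c c' : sgE c *m sgE c' = if c == c' then sgE c else 0.
Proof.
apply/matrixP=> i j; rewrite mul_mx_diag !mxE.
case: (eqVneq i j) => [->|ij]; last first.
  by rewrite mulr0n mul0r; case: ifP; rewrite !mxE ?(negbTE ij) ?mulr0n.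
rewrite mulr1n; case: (eqVneq (s j) c) => [sj|h].
  by rewrite mul1r sj; case: ifP; rewrite !mxE -/(s j) ?sj ?eqxx.
by rewrite mul0r; case: ifP; rewrite !mxE -/(s j) ?(negbTE h) ?mul0rn.
Qed.

Lemma sgE_blk c M : sgE c *m blk M *m sgE c = sgE c *m M *m sgE c.
Proof.
apply/matrixP=> i j; rewrite !sgE_sandwich mxE.
case: (eqVneq (s i) c) => [->|]; last by rewrite !mul0r.
by case: (eqVneq (s j) c) => [_|_]; rewrite ?mulr0.
Qed.

Lemma sg_cases i : [\/ s i = 1, s i = 0 | s i = -1].
Proof. by rewrite /s; case: sgrP; [constructor 2|constructor 1|constructor 3]. Qed.

Lemma blk_decomp M : blk M =
  sgE 1 *m M *m sgE 1 + sgE 0 *m M *m sgE 0 + sgE (-1) *m M *m sgE (-1).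
Proof.
have e1 : (1 == 0 :> R) = false by apply/eqP; lra.
have e2 : (1 == -1 :> R) = false by apply/eqP; lra.
have e3 : (0 == 1 :> R) = false by apply/eqP; lra.
have e4 : (0 == -1 :> R) = false by apply/eqP; lra.
have e5 : (-1 == 0 :> R) = false by apply/eqP; lra.
have e6 : (-1 == 1 :> R) = false by apply/eqP; lra.
apply/matrixP=> i j; rewrite [RHS]mxE [X in _ = X + _]mxE !sgE_sandwich mxE.
by case: (sg_cases i) => ->; case: (sg_cases j) => ->;
  rewrite ?eqxx ?(e1, e2, e3, e4, e5, e6) ?mul0r ?mulr0 ?mulr1 ?mul1r ?addr0 ?add0r.
Qed.

Lemma sgE_psd (c : R) (F : 'M[R]_n) : symm F ->
  (forall i, s i = c -> \sum_j `|F i j| <= c * l 0 i) ->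
  psd (c *: (sgE c *m L *m sgE c) + sgE c *m F *m sgE c).
Proof.
move=> sF hF; pose d := \row_i ((s i == c)%:R * (c * l 0 i)).
have -> : c *: (sgE c *m L *m sgE c) = diag_mx d.
  apply/matrixP=> i j; rewrite mxE sgE_sandwich !mxE.
  case: (eqVneq i j) => [->|_]; last by rewrite !mulr0n mulr0 mul0r mulr0.
  by rewrite !mulr1n; case: eqP => _; rewrite ?mul0r ?mul1r ?mulr0 ?mulr1.
apply: psd_diag_dominant.
  by rewrite -[X in _ *m X](sgE_symm c); exact: symm_sandwich.
move=> i; rewrite mxE; case: (eqVneq (s i) c) => [si|si].
  rewrite mul1r; apply: le_trans (hF i si); apply: ler_sum => j _.
  rewrite sgE_sandwich si eqxx mul1r normrM; case: eqP => _; rewrite ?normr1 ?normr0 ?mulr1//.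
  by rewrite mulr0.
rewrite mul0r big1// => j _; rewrite sgE_sandwich (negbTE si) !mul0r normr0.
by [].
Qed.

(** On the block of sign [c] the matrix [c *: L] has diagonal entries [|l_i| > 0], which eventually
    dominate the perturbation [c *: (D t - L)]. *)
Lemma near_sgE_psd (D : R -> 'M[R]_n) (c : R) : c != 0 -> (forall t, symm (D t)) ->
  D t @[t --> 0^'+] --> L ->
  \forall t \near 0^'+, psd (c *: (sgE c *m D t *m sgE c)).
Proof.
move=> c0 sD DL.
have h i : s i = c -> \forall t \near 0^'+, \sum_j `|(c *: (D t - L)) i j| <= c * l 0 i.
  move=> si; have cl : 0 < c * l 0 i.
    by move: c0; rewrite -si /s -normrEsg sgr_eq0 normr_gt0.
  have : (\sum_j `|(c *: (D t - L)) i j|) @[t --> 0^'+] --> \sum_(j < n) `|(c *: (L - L)) i j|.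
    apply: cvg_sum_fin => j; apply: cvg_norm; apply: mx_cvg_entry.
    by apply: cvgZ; [exact: cvg_cst | apply: cvgB => //; exact: cvg_cst].
  rewrite big1; last by move=> j _; rewrite subrr scaler0 mxE normr0.
  by move=> h; apply: (cvgr_le 0).
have h' : \forall t \near 0^'+, forall i, s i = c -> \sum_j `|(c *: (D t - L)) i j| <= c * l 0 i.
  apply: filter_forall => i; case: (eqVneq (s i) c) => [/h|/eqP si].
    by apply: filterS => t ht _.
  by near=> t => /si.
apply: filterS h' => t ht.
have -> : c *: (sgE c *m D t *m sgE c) =
  c *: (sgE c *m L *m sgE c) + sgE c *m (c *: (D t - L)) *m sgE c.
  rewrite -scalemxAr -scalemxAl -scalerDr -mulmxDl -mulmxDr [L + _]addrC subrK.
  by [].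
apply: sgE_psd => //; apply/symmZ/symmB => //; exact: symm_diag.
Unshelve. all: by end_near. Qed.

End SignBlocks.

(** * Expansion at a diagonal matrix *)

Section MoreJets.
Variables (R : realType).

Lemma jet1_lr m n p q (M : 'M[R]_(p, m)) (N : 'M[R]_(n, q)) (f : R -> 'M[R]_(m, n)) a b :
  jet1 f a b -> jet1 (fun t => M *m f t *m N) (M *m a *m N) (M *m b *m N).
Proof.
move=> jf; have := jet1M (jet1M (jet1_cst M) jf) (jet1_cst N).
by rewrite mul0mx mulmx0 addr0 add0r.
Qed.

Lemma jet2_shift m n (r : R -> 'M[R]_(m, n)) b c :
  jet1 r b c -> jet2 (fun t => t *: r t) 0 b c.
Proof. by move=> rb; exists r; split=> //; near=> t; rewrite add0r.
Unshelve. all: by end_near. Qed.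

Lemma jet2_lr m n p q (M : 'M[R]_(p, m)) (N : 'M[R]_(n, q)) (f : R -> 'M[R]_(m, n)) a b c :
  jet2 f a b c ->
  jet2 (fun t => M *m f t *m N) (M *m a *m N) (M *m b *m N) (M *m c *m N).
Proof.
move=> [r [rb fr]]; exists (fun t => M *m r t *m N); split; first exact: jet1_lr.
apply: filterS fr => t ->.
by rewrite mulmxDr mulmxDl -scalemxAr -scalemxAl.
Qed.

Lemma jet1_lim n (f : R -> 'M[R]_n) a b a' :
  jet1 f a b -> f t @[t --> 0^'+] --> a' -> a = a'.
Proof. by move=> /jet1_cvg; apply: cvg_unique; exact: norm_hausdorff. Qed.

Lemma jet1_dir1 n (F : 'M[R]_n -> 'M[R]_n) Z H T :
  jet1 (fun t => F (Z + t *: H)) (F Z) T -> dir1 F Z H = T.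
Proof. by move=> /jet1_quotient h; apply: cvg_lim => //; exact: norm_hausdorff. Qed.

End MoreJets.

Section DiagonalExpansion.
Variables (R : realType) (n : nat) (l : 'rV[R]_n) (h : 'M[R]_n).
Hypothesis sh : symm h.
Implicit Types (w g : 'M[R]_n) (t : R).

Let L := diag_mx l.
Let E1 := sgE l 1.
Let E0 := sgE l 0.
Let A := adinv l h.
Let D1 := blk l h.
Let h0 := E0 *m h *m E0.
Let Y0 := E1 *m L *m E1.
Let Y1 := E1 *m h *m E1 + Pplus h0.

(* The [t^2]-coefficient left over once [1 + tA] has been applied; its block
   diagonal part and its image under [adinv] enter [D] and [B]. *)
Definition corr w : 'M[R]_n :=
  2^-1 *: w - (2^-1 *: (A *m A *m L + L *m A *m A) - A *m L *m A + A *m D1 - D1 *m A).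
(** [A *m A / 2] is the second coefficient of the exponential of [tA] and keeps [U] orthogonal to
    second order. The other term is skew, so it preserves this, and it clears the part of [corr w]
    outside the blocks. *)
Let B w := 2^-1 *: (A *m A) + adinv l (corr w).
Let U w t := 1%:M + t *: A + t ^+ 2 *: B w.
Let D w t := L + t *: D1 + t ^+ 2 *: blk l (corr w).
Let X w t := L + t *: h + t ^+ 2 *: (2^-1 *: w).

Let sL : symm L. Proof. exact: symm_diag. Qed.
Let sE0 : symm E0. Proof. exact: sgE_symm. Qed.
Let sD1 : symm D1. Proof. exact: blk_symm. Qed.
Let At : A^T = - A. Proof. exact: adinv_tr. Qed.

Lemma corr_symm w : symm w -> symm (corr w).
Proof.
move=> sw.
have s1 : symm (A *m A *m L + L *m A *m A).
  rewrite /symm linearD /= !trmx_mul At [L^T]sL !(mulmxN, mulNmx) !opprK !mulmxA.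
  exact: addrC.
have s2 : symm (A *m L *m A).
  by rewrite /symm !trmx_mul At [L^T]sL !(mulmxN, mulNmx) opprK mulmxA.
have s3 : symm (A *m D1 - D1 *m A).
  by rewrite /symm linearB /= !trmx_mul At [D1^T]sD1 mulmxN mulNmx opprK addrC.
rewrite /corr -[_ + A *m D1 - _]addrA; apply: symmB; first exact: symmZ.
by apply: symmD => //; apply: symmB => //; exact: symmZ.
Qed.

Lemma U_jet2 w : jet2 (U w) 1%:M A (B w).
Proof. exact: jet2_poly. Qed.

Lemma Ut_jet2 w : symm w ->
  jet2 (fun t => (U w t)^T) 1%:M (- A) (2^-1 *: (A *m A) - adinv l (corr w)).
Proof.
move=> sw; have := jet2_tr (U_jet2 w); rewrite trmx1 At /B linearD linearZ /= trmx_mul At.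
by rewrite mulmxN mulNmx opprK adinv_tr//; exact: corr_symm.
Qed.

Lemma UtU_jet2 w : symm w -> jet2 (fun t => (U w t)^T *m U w t) 1%:M 0 0.
Proof.
move=> sw; have := jet2M (Ut_jet2 sw) (U_jet2 w).
rewrite /B !mul1mx !mulmx1 subrr mulNmx.
move: (A *m A) (adinv l (corr w)) => a k.
rewrite (_ : 2^-1 *: a + k + (2^-1 *: a - k) - a = 0) //.
by apply/matrixP=> i j; rewrite !mxE; field.
Qed.

Lemma D_jet2 w : jet2 (D w) L D1 (blk l (corr w)).
Proof. exact: jet2_poly. Qed.

Lemma UDU_jet2 w : symm w ->
  jet2 (fun t => U w t *m D w t *m (U w t)^T) L h (2^-1 *: w).
Proof.
move=> sw; have := jet2M (jet2M (U_jet2 w) (D_jet2 w)) (Ut_jet2 sw).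
have hE : h = A *m L - L *m A + D1 by rewrite adinvP.
have gE : blk l (corr w) = corr w - (adinv l (corr w) *m L - L *m adinv l (corr w)).
  by rewrite -[X in X - _](adinvP l (corr w)) addrC addKr.
rewrite !mul1mx !mulmx1.
rewrite (_ : L *m - A + (D1 + A *m L) = h); last first.
  rewrite hE mulmxN; move: (A *m L) (L *m A) => a b.
  by apply/matrixP=> i j; rewrite !mxE; ring.
rewrite gE /B.
set k := adinv l (corr w).
rewrite !(mulmxDl, mulmxDr, mulmxN, mulNmx) -!scalemxAl -!scalemxAr /corr !mulmxA.
move: (A *m A *m L) (L *m A *m A) (A *m L *m A) (A *m D1) (D1 *m A) (k *m L) (L *m k) => a b c d e f g.
set z := (X in jet2 _ _ _ X -> _); rewrite (_ : z = 2^-1 *: w) //.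
by apply/matrixP=> i j; rewrite /z !mxE; field.
Qed.

Lemma dotm_sgE0 c c' M N : c != c' ->
  dotm (sgE l c *m M *m sgE l c) (sgE l c' *m N *m sgE l c') = 0.
Proof.
move=> cc'; rewrite dotmM_r [(sgE l c)^T]sgE_symm -mulmxA sgE_mul.
by rewrite eq_sym (negbTE cc') mulmx0 dotm0r.
Qed.

Lemma E0L : E0 *m L = 0.
Proof.
apply/matrixP=> i j; rewrite mul_diag_mx !mxE sgr_eq0.
by case: (eqVneq i j) => [->|_]; rewrite ?mulr0n ?mulr0//; case: eqP => [->|_]; rewrite ?mul0r ?mulr0 ?mul0rn ?mulr0.
Qed.

Lemma LE0 : L *m E0 = 0.
Proof. by have := congr1 trmx E0L; rewrite trmx_mul trmx0 [E0^T]sE0 [L^T]sL. Qed.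

Lemma D_symm w t : symm w -> symm (D w t).
Proof.
move=> sw; apply: symmD; first by apply: symmD => //; exact: symmZ.
by apply/symmZ/blk_symm/corr_symm.
Qed.

Lemma blkD M N : blk l (M + N) = blk l M + blk l N.
Proof. by apply/matrixP=> i j; rewrite !mxE; case: ifP => _; rewrite ?addr0. Qed.
Lemma blkZ a M : blk l (a *: M) = a *: blk l M.
Proof. by apply/matrixP=> i j; rewrite !mxE; case: ifP => _; rewrite ?mulr0. Qed.
Lemma blk_diag : blk l L = L.
Proof.
apply/matrixP=> i j; rewrite !mxE; case: (eqVneq i j) => [->|_]; first by rewrite eqxx.
by rewrite mulr0n if_same.
Qed.

Lemma near_Pplus_D w : symm w -> \forall t \near 0^'+,
  Pplus (D w t) = E1 *m D w t *m E1 +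
                  t *: Pplus (h0 + t *: (E0 *m corr w *m E0)).
Proof.
move=> sw.
have DL := jet1_cvg (jet2_jet1 (D_jet2 w)).
have nz1 : (1 : R) != 0 by exact: oner_neq0.
have nzm1 : (-1 : R) != 0 by rewrite oppr_eq0.
have sD t := D_symm t sw.
near=> t; have t0 : 0 < t by near: t; exact: nbhs_right_gt.
have p1 : psd (1 *: (E1 *m D w t *m E1)) by near: t; exact: near_sgE_psd.
have p2 : psd (-1 *: (sgE l (-1) *m D w t *m sgE l (-1))) by near: t; exact: near_sgE_psd.
rewrite scale1r in p1.
pose N' := E0 *m (h + t *: corr w) *m E0.
have N'E : h0 + t *: (E0 *m corr w *m E0) = N'.
  by rewrite /N'; move: (corr w) => g; rewrite mulmxDr mulmxDl -scalemxAr -scalemxAl.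
rewrite N'E.
have sN : symm (h + t *: corr w) by apply: symmD => //; apply/symmZ/corr_symm.
have E00 : E0 *m E0 = E0 by rewrite sgE_mul eqxx.
have sN' : symm N' by rewrite /N' -[X in _ *m X]sE0; exact: symm_sandwich.
have [q1 q2 q3] := PplusP sN'.
(* The projected kernel block stays in the kernel block, hence is orthogonal to the other two. *)
have PE : E0 *m Pplus N' *m E0 = Pplus N' by exact: Pplus_compress.
have NE : E0 *m N' *m E0 = N' by rewrite /N' !mulmxA E00 -mulmxA E00.
have PNE : Pplus N' - N' = E0 *m (Pplus N' - N') *m E0 by rewrite mulmxBr mulmxBl PE NE.
have DE : D w t = E1 *m D w t *m E1 + t *: N' + sgE l (-1) *m D w t *m sgE l (-1).
  pose X0 := L + t *: h + t ^+ 2 *: corr w.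
  have DX : D w t = blk l X0.
    by rewrite /D /X0; move: (corr w) => g; rewrite !blkD !blkZ blk_diag.
  rewrite DX !sgE_blk blk_decomp; congr (_ + _ + _).
  (* [L] vanishes on the kernel block, so a factor [t] comes out. *)
  rewrite /X0 /N'; move: (corr w) => g; rewrite !mulmxDr !mulmxDl -/E0 E0L mul0mx add0r.
  by rewrite -!scalemxAr -!scalemxAl scalerDr scalerA expr2.
have YD : E1 *m D w t *m E1 + t *: Pplus N' - D w t =
   t *: (Pplus N' - N') + -1 *: (sgE l (-1) *m D w t *m sgE l (-1)).
  rewrite {2}DE; move: (E1 *m D w t *m E1) (Pplus N') (N') (sgE _ _ *m _ *m _) => a b c d.
  by apply/matrixP=> i j; rewrite !mxE; ring.
apply: Pplus_unique.
- by apply: psdD => //; apply: psdZ => //; exact: ltW.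
- by rewrite YD; apply: psdD => //; apply: psdZ => //; exact: ltW.
have e1 : (1 : R) != 0 by exact: oner_neq0.
have e2 : (1 : R) != -1 by apply/eqP; lra.
have e3 : (0 : R) != -1 by apply/eqP; lra.
rewrite YD !dotmDl !dotmDr !dotmZl !dotmZr q3 PNE dotm_sgE0// dotm_sgE0//.
by rewrite -PE dotm_sgE0// !mulr0 !addr0.
Unshelve. all: by end_near. Qed.

Lemma Y1E : E1 *m D1 *m E1 + Pplus h0 = Y1.
Proof. by rewrite sgE_blk. Qed.

Lemma h0_symm : symm h0.
Proof. by rewrite /h0 -[X in _ *m X]sE0; exact: symm_sandwich. Qed.

Lemma X_symm w t : symm w -> symm (X w t).
Proof. by move=> sw; apply: symmD; [apply: symmD => //; exact: symmZ | do 2!apply: symmZ]. Qed.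

Lemma Pplus_X_remainder w : symm w ->
  jet2 (fun t => Pplus (X w t) - U w t *m Pplus (D w t) *m (U w t)^T) 0 0 0.
Proof.
move=> sw; apply: (Pplus_conj_jet _ _ sL (UtU_jet2 sw) _ (UDU_jet2 sw)).
- by move=> t; exact: D_symm.
- by move=> t; exact: X_symm.
- exact: jet1_cvg (jet2_jet1 (D_jet2 w)).
- exact: jet2_poly.
Qed.

(** The commutator with [A] comes from rotating [Y0], and [Y1] from the block diagonal part. *)
Definition diag_deriv : 'M[R]_n := A *m Y0 - Y0 *m A + Y1.

Lemma sandwich_E0_symm g : symm g -> symm (E0 *m g *m E0).
Proof. by move=> sg; rewrite -[X in _ *m X]sE0; exact: symm_sandwich. Qed.

Lemma Pplus_diag_jet1 w : symm w -> jet1 (fun t => Pplus (X w t)) Y0 diag_deriv.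
Proof.
move=> sw; have jD := jet2_jet1 (D_jet2 w).
have jP : jet1 (fun t => t *: Pplus (h0 + t *: (E0 *m corr w *m E0))) 0 (Pplus h0).
  apply: jet1_shift; apply: Pplus_cvg => [t||].
  - by apply: symmD; [exact: h0_symm | apply/symmZ/sandwich_E0_symm/corr_symm].
  - exact: h0_symm.
  - exact: jet1_cvg (jet1_affine _ _).
have jY : jet1 (fun t => Pplus (D w t)) Y0 Y1.
  have := jet1D (jet1_lr E1 E1 jD) jP; rewrite Y1E addr0.
  by apply: near_jet1; apply: filterS (near_Pplus_D sw) => t ->.
have := jet1D (jet2_jet1 (Pplus_X_remainder sw))
              (jet1M (jet1M (jet2_jet1 (U_jet2 w)) jY) (jet2_jet1 (Ut_jet2 sw))).
rewrite !mul1mx !mulmx1 !add0r mulmxN.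
rewrite (_ : - (Y0 *m A) + (Y1 + A *m Y0) = diag_deriv); last first.
  rewrite /diag_deriv; move: (Y0 *m A) (A *m Y0) Y1 => a b c.
  by apply/matrixP=> i j; rewrite !mxE; ring.
by apply: near_jet1; near=> t; rewrite subrK.
Unshelve. all: by end_near. Qed.

Definition lin_part g : 'M[R]_n := adinv l g *m Y0 - Y0 *m adinv l g + E1 *m g *m E1.

Definition diag_deriv2 w : 'M[R]_n :=
  2^-1 *: (A *m A *m Y0 + Y0 *m A *m A) - A *m Y0 *m A + A *m Y1 - Y1 *m A +
  lin_part (corr w) + dir1 (@Pplus R n) h0 (E0 *m corr w *m E0).

(** The kernel block calls for a first-order expansion of [Pplus] at [h0], which need not be
    diagonal. It is therefore a hypothesis here, discharged once the first-order result has been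
    carried to all symmetric matrices. *)
Lemma Pplus_diag_jet2 w : symm w ->
  jet1 (fun t => Pplus (h0 + t *: (E0 *m corr w *m E0))) (Pplus h0)
       (dir1 (@Pplus R n) h0 (E0 *m corr w *m E0)) ->
  jet2 (fun t => Pplus (X w t)) Y0 diag_deriv (diag_deriv2 w).
Proof.
move=> sw jP; have jD := D_jet2 w.
set T := dir1 _ _ _ in jP *.
have jY : jet2 (fun t => Pplus (D w t)) Y0 Y1 (E1 *m corr w *m E1 + T).
  have := jet2D (jet2_lr E1 E1 jD) (jet2_shift jP); rewrite Y1E addr0 sgE_blk.
  by apply: near_jet2; apply: filterS (near_Pplus_D sw) => t ->.
have := jet2D (Pplus_X_remainder sw) (jet2M (jet2M (U_jet2 w) jY) (Ut_jet2 sw)).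
rewrite !mul1mx !mulmx1 !add0r mulmxN.
rewrite (_ : - (Y0 *m A) + (Y1 + A *m Y0) = diag_deriv); last first.
  rewrite /diag_deriv; move: (Y0 *m A) (A *m Y0) Y1 => a b c.
  by apply/matrixP=> i j; rewrite !mxE; ring.
rewrite /diag_deriv2 -/T /lin_part /B.
set z := (X in jet2 _ _ _ X -> _); set z' := (X in _ -> jet2 _ _ _ X).
rewrite (_ : z = z').
  by apply: near_jet2; near=> t; rewrite subrK.
rewrite /z /z'; move: (T) (adinv l (corr w)) (E1 *m corr w *m E1) => x k o.
move: (Y1) (Y0) (A) => y1 y0 a.
rewrite !(mulmxDl, mulmxDr, mulmxN, mulNmx) -!scalemxAl -!scalemxAr !mulmxA.
move: (a *m a *m y0) (y0 *m a *m a) (a *m y0 *m a) => b c d.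
move: (a *m y1) (y1 *m a) (k *m y0) (y0 *m k) => e f g p.
by apply/matrixP=> i j; rewrite !mxE; field.
Unshelve. all: by end_near. Qed.

Lemma corrD v u : corr (v + u) = 2^-1 *: v + corr u.
Proof. by rewrite /corr scalerDr addrA. Qed.

(** As [0^-1 = 0], this is the pseudoinverse of [L]. *)
Let Li := diag_mx (\row_i (l 0 i)^-1).

(* The kernel block of the second-order correction is what [Upsilon] cancels. *)
Lemma corr_upsilon : E0 *m corr (2%:R *: (E0 *m h *m Li *m h *m E0)) *m E0 = 0.
Proof.
have E00 : E0 *m E0 = E0 by rewrite sgE_mul eqxx.
have EAE : E0 *m A *m E0 = 0.
  apply/matrixP=> i j; rewrite sgE_sandwich !mxE.
  case: (eqVneq (Num.sg (l 0 i)) 0) => [->|_]; last by rewrite !mul0r.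
  by case: (eqVneq (Num.sg (l 0 j)) 0) => _; rewrite ?mulr0 ?mul0r.
have DE : D1 *m E0 = E0 *m D1.
  apply/matrixP=> i j; rewrite mul_diag_mx mul_mx_diag !mxE.
  by case: (eqVneq (Num.sg (l 0 i)) (Num.sg (l 0 j))) => [->|_]; rewrite ?mul0r ?mulr0// mulrC.
(* For [j] in the kernel the denominator [l_j - l_i] in [adinv] is [- l_i]. *)
have AE : A *m E0 = - (Li *m h *m E0).
  apply/matrixP=> i j; rewrite [RHS]mxE !mul_mx_diag !mul_diag_mx !mxE sgr_eq0.
  case: (eqVneq (l 0 j) 0) => [->|_]; last by rewrite !mulr0 oppr0.
  rewrite sgr0 sgr_eq0 sub0r !mulr1; case: (eqVneq (l 0 i) 0) => [->|li].
    by rewrite invr0 mul0r oppr0.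
  by rewrite invrN mulrN mulrC.
have EALL : E0 *m A *m L *m Li = E0 *m h *m Li.
  apply/matrixP=> i j; rewrite !mul_mx_diag !mul_diag_mx !mxE sgr_eq0.
  case: (eqVneq (l 0 i) 0) => [->|_]; last by rewrite !mul0r.
  rewrite sgr0 eq_sym sgr_eq0 subr0; case: (eqVneq (l 0 j) 0) => [->|lj].
    by rewrite invr0 !mulr0.
  by rewrite !mul1r mulfVK.
rewrite /corr scalerA mulVf ?pnatr_eq0// scale1r.
set u := E0 *m h *m Li *m h *m E0.
have uE : E0 *m u *m E0 = u by rewrite /u !mulmxA E00 -[in LHS]mulmxA E00.
have ALA : E0 *m (A *m L *m A) *m E0 = - u.
  by rewrite -!mulmxA AE !mulmxN !mulmxA EALL.
have t1 : E0 *m (A *m A *m L) *m E0 = 0 by rewrite -!mulmxA LE0 !mulmx0.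
have t2 : E0 *m (L *m A *m A) *m E0 = 0 by rewrite !mulmxA E0L !mul0mx.
have t3 : E0 *m (A *m D1) *m E0 = 0 by rewrite -!mulmxA DE !mulmxA EAE mul0mx.
have t4 : E0 *m (D1 *m A) *m E0 = 0 by rewrite !mulmxA -DE -!mulmxA [E0 *m (A *m _)]mulmxA EAE mulmx0.
rewrite !(mulmxBr, mulmxBl, mulmxDr, mulmxDl) -!scalemxAr -!scalemxAl.
rewrite !(mulmxDr, mulmxDl, mulmxN, mulNmx) t1 t2 t3 t4 ALA uE.
by rewrite oppr0 !addr0 scaler0 add0r opprK subrr.
Qed.

Lemma lin_partZ a g : lin_part (a *: g) = a *: lin_part g.
Proof.
by rewrite /lin_part adinvZ -!scalemxAr -!scalemxAl scalerDr scalerBr.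
Qed.
Lemma lin_partD g g' : lin_part (g + g') = lin_part g + lin_part g'.
Proof.
rewrite /lin_part adinvD !(mulmxDr, mulmxDl).
move: (_ *m Y0) (_ *m Y0) (Y0 *m _) (Y0 *m _) (E1 *m _ *m _) (E1 *m _ *m _) => a b c d e f.
by apply/matrixP=> i j; rewrite !mxE; ring.
Qed.

End DiagonalExpansion.

(** * Directional derivatives *)

Section JetOperations.
Variables (R : realType) (m n : nat).
Implicit Types f : R -> 'M[R]_(m, n).

Lemma jet1N f a b : jet1 f a b -> jet1 (fun t => - f t) (- a) (- b).
Proof.
move=> [r [rb fr]]; exists (fun t => - r t); split; first exact: cvgN.
by apply: filterS fr => t ->; rewrite opprD scalerN.
Qed.

Lemma jet2N f a b c : jet2 f a b c -> jet2 (fun t => - f t) (- a) (- b) (- c).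
Proof.
move=> [r [rb fr]]; exists (fun t => - r t); split; first exact: jet1N.
by apply: filterS fr => t ->; rewrite opprD scalerN.
Qed.

Lemma cvg_scale_right0 (k : R) : 0 < k -> k * t @[t --> 0^'+] --> 0^'+.
Proof.
move=> k0 S [e /= e0 eS]; exists (k^-1 * e) => /=; first by rewrite mulr_gt0 ?invr_gt0.
move=> t /=; rewrite !sub0r !normrN => te t0; apply: eS; last exact: mulr_gt0.
by rewrite /= sub0r normrN normrM gtr0_norm// mulrC -ltr_pdivlMr// mulrC.
Qed.

(** The source of the positive homogeneity of directional derivatives. *)
Lemma jet1_reparam f a b k : 0 < k -> jet1 f a b ->
  jet1 (fun t => f (k * t)) a (k *: b).
Proof.
move=> k0 [r [rb fr]]; exists (fun t => k *: r (k * t)); split.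
  apply: cvgZ; first exact: cvg_cst.
  exact: (cvg_comp (fun t => k * t) r (cvg_scale_right0 k0) rb).
have : \forall t \near 0^'+, f (k * t) = a + (k * t) *: r (k * t).
  exact: (cvg_scale_right0 k0 fr).
by apply: filterS => t ->; rewrite scalerA mulrC.
Qed.
End JetOperations.

Section SymmetricData.
Variables (R : realType) (n : nat).
Implicit Types Z H W V : 'M[R]_n.
Local Notation Pp := (@Pplus R n).

Lemma symm_conj V W : symm W -> symm (V^T *m W *m V).
Proof. by move=> sW; rewrite -[X in _ *m X]trmxK; exact: symm_sandwich. Qed.

Lemma conjK V W : V *m V^T = 1%:M -> V *m (V^T *m W *m V) *m V^T = W.
Proof. by move=> VV; rewrite !mulmxA VV mul1mx -mulmxA VV mulmx1. Qed.

Lemma Pplus_jet1 Z H : symm Z -> symm H ->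
  jet1 (fun t => Pplus (Z + t *: H)) (Pplus Z) (dir1 Pp Z H).
Proof.
move=> sZ sH; have [V [l [V1 V2 ZE]]] := symm_spectral sZ.
have sh := symm_conj V sH.
have j := jet1_lr V V^T (Pplus_diag_jet1 l sh (@symm0 R n)).
have j1 : jet1 (fun t => Pplus (Z + t *: H))
   (V *m (sgE l 1 *m diag_mx l *m sgE l 1) *m V^T)
   (V *m diag_deriv l (V^T *m H *m V) *m V^T).
  apply: near_jet1 j; near=> t; rewrite -Pplus_conj//; last first.
    by apply: symmD; [apply: symmD; [exact: symm_diag | exact: symmZ] | do 2!apply: symmZ; exact: symm0].
  rewrite scaler0 scaler0 addr0 mulmxDr mulmxDl -ZE -scalemxAr -scalemxAl conjK//.
(* The constant coefficient is recognised as [Pplus Z] by continuity and uniqueness of limits. *)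
have Z0 : V *m (sgE l 1 *m diag_mx l *m sgE l 1) *m V^T = Pplus Z.
  apply: (jet1_lim j1); apply: Pplus_cvg => //.
    by move=> t; apply: symmD => //; exact: symmZ.
  exact: jet1_cvg (jet1_affine _ _).
by rewrite Z0 in j1; rewrite (jet1_dir1 j1).
Unshelve. all: by end_near. Qed.

Lemma dir1_Pplus_scale Z H a : symm Z -> symm H -> 0 < a ->
  dir1 Pp Z (a *: H) = a *: dir1 Pp Z H.
Proof.
move=> sZ sH a0; apply: jet1_dir1; have := jet1_reparam a0 (Pplus_jet1 sZ sH).
by apply: near_jet1; near=> t; rewrite scalerA mulrC.
Unshelve. all: by end_near. Qed.

Lemma dir1_Pplus0 Z : dir1 Pp Z 0 = 0.
Proof.
apply: jet1_dir1; apply: near_jet1 (jet1_cst (Pplus Z)).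
by near=> t; rewrite scaler0 addr0.
Unshelve. all: by end_near. Qed.

Section Rotated.
Variables (Z H V : 'M[R]_n) (l : 'rV[R]_n).
Hypotheses (sH : symm H) (V1 : V^T *m V = 1%:M) (V2 : V *m V^T = 1%:M).
Hypothesis ZE : Z = V *m diag_mx l *m V^T.
Let h := V^T *m H *m V.

Let sZ : symm Z.
Proof. by rewrite ZE; apply: symm_sandwich; exact: symm_diag. Qed.

Lemma Pplus_jet2 W : symm W ->
  jet2 (fun t => Pplus (Z + t *: H + (t ^+ 2 / 2) *: W)) (Pplus Z) (dir1 Pp Z H)
       (V *m diag_deriv2 l h (V^T *m W *m V) *m V^T).
Proof.
move=> sW; have sh : symm h := symm_conj V sH; have sw := symm_conj V sW.
have sE0 g : symm g -> symm (sgE l 0 *m g *m sgE l 0).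
  by move=> sg; rewrite -[X in _ *m X](sgE_symm l 0); exact: symm_sandwich.
have i2 := jet2_lr V V^T (@Pplus_diag_jet2 _ _ l h sh _ sw
  (Pplus_jet1 (sE0 _ sh) (sE0 _ (@corr_symm _ _ l h sh _ sw)))).
set a := V *m _ *m _ in i2; set b := V *m _ *m _ in i2; set c := V *m _ *m _ in i2.
have j : jet2 (fun t => Pplus (Z + t *: H + (t ^+ 2 / 2) *: W)) a b c.
  apply: near_jet2 i2; near=> t; rewrite /= -Pplus_conj//; last first.
    by apply: symmD; [apply: symmD; [exact: symm_diag | exact: symmZ] | do 2!apply: symmZ].
  by rewrite !mulmxDr !mulmxDl -ZE -!scalemxAr -!scalemxAl !conjK// scalerA.
have a0 : a = Pplus Z.
  apply: (jet1_lim (jet2_jet1 j)); apply: Pplus_cvg => //.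
    by move=> t; apply: symmD; [apply: symmD => //; exact: symmZ | exact: symmZ].
  rewrite -[X in _ --> X](_ : Z + 0 *: H + 0 *: W = Z); last by rewrite !scale0r !addr0.
  apply: cvgD; first by apply: cvgD; [exact: cvg_cst | apply: cvgZ; [exact: cvg_id_right0 | exact: cvg_cst]].
  apply: cvgZ; last exact: cvg_cst.
  rewrite -[X in _ --> X](_ : 0 * 0 * 2^-1 = 0 :> R); last by rewrite !mul0r.
  by apply: cvgM; [apply: cvgM; exact: cvg_id_right0 | exact: cvg_cst].
(* The first-order coefficient does not depend on [W], so the case [W = 0] identifies it. *)
have b0 : b = dir1 Pp Z H.
  have j0 := jet1_lr V V^T (Pplus_diag_jet1 l sh (@symm0 R n)).
  rewrite -/a -/b in j0; apply/esym/jet1_dir1; rewrite -a0.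
  apply: near_jet1 j0; near=> t; rewrite -Pplus_conj//; last first.
    by apply: symmD; [apply: symmD; [exact: symm_diag | exact: symmZ] | do 2!apply: symmZ; exact: symm0].
  by rewrite scaler0 scaler0 addr0 mulmxDr mulmxDl -ZE -scalemxAr -scalemxAl conjK.
by rewrite -a0 -b0.
Unshelve. all: by end_near. Qed.

End Rotated.

(** The factor 2 passes from the coefficient of [t ^+ 2] to the quotient by [t ^+ 2 / 2]. *)
Lemma jet2_dir2 (F : 'M[R]_n -> 'M[R]_n) Z H W c :
  jet2 (fun t => F (Z + t *: H + (t ^+ 2 / 2) *: W)) (F Z) (dir1 F Z H) c ->
  (t ^+ 2 / 2)^-1 *: (F (Z + t *: H + (t ^+ 2 / 2) *: W) - F Z - t *: dir1 F Z H)
    @[t --> 0^'+] --> 2%:R *: c.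
Proof.
have E (t : R) : (t ^+ 2 / 2)^-1 = 2 * (t ^+ 2)^-1 by rewrite invfM invrK mulrC.
move=> /jet2_quotient j; under eq_fun do rewrite E -scalerA.
by apply: cvgZ => //; exact: cvg_cst.
Qed.

Lemma dir2E (F : 'M[R]_n -> 'M[R]_n) Z H W c :
  jet2 (fun t => F (Z + t *: H + (t ^+ 2 / 2) *: W)) (F Z) (dir1 F Z H) c ->
  dir2 F Z H W = 2%:R *: c.
Proof. by move=> /jet2_dir2 h; apply: cvg_lim => //; exact: norm_hausdorff. Qed.

Lemma Pplus_dir2_cvg Z H W : symm Z -> symm H -> symm W ->
  (t ^+ 2 / 2)^-1 *: (Pplus (Z + t *: H + (t ^+ 2 / 2) *: W) - Pplus Z - t *: dir1 Pp Z H)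
    @[t --> 0^'+] --> dir2 Pp Z H W.
Proof.
move=> sZ sH sW; have [V [l [V1 V2 ZE]]] := symm_spectral sZ.
have j := Pplus_jet2 sH V1 V2 ZE sW; rewrite (dir2E j).
exact: jet2_dir2.
Qed.

Lemma dir1_Pminus Z H : symm Z -> symm H ->
  dir1 (@Pminus R n) Z H = H - dir1 Pp Z H.
Proof.
move=> sZ sH; apply: jet1_dir1; rewrite Pminus_Pplus//.
have := jet1D (jet1_affine Z H) (jet1N (Pplus_jet1 sZ sH)).
by apply: near_jet1; near=> t; rewrite Pminus_Pplus//; apply: symmD => //; exact: symmZ.
Unshelve. all: by end_near. Qed.

Lemma dir2_Pminus Z H W : symm Z -> symm H -> symm W ->
  dir2 (@Pminus R n) Z H W = W - dir2 Pp Z H W.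
Proof.
move=> sZ sH sW; have [V [l [V1 V2 ZE]]] := symm_spectral sZ.
have j := Pplus_jet2 sH V1 V2 ZE sW; rewrite (dir2E j); set c := V *m _ *m _ in j *.
have -> : W - 2%:R *: c = 2%:R *: (2^-1 *: W - c).
  by rewrite scalerBr scalerA divff ?pnatr_eq0// scale1r.
apply: dir2E; rewrite dir1_Pminus// Pminus_Pplus//.
have := jet2D (jet2_poly Z H (2^-1 *: W)) (jet2N j).
apply: near_jet2; near=> t; rewrite scalerA Pminus_Pplus//.
by apply: symmD; [apply: symmD => //; exact: symmZ | exact: symmZ].
Unshelve. all: by end_near. Qed.

Lemma dir2_Pplus_symm Z H W : symm Z -> symm H -> symm W -> symm (dir2 Pp Z H W).
Proof.
move=> sZ sH sW; have h := Pplus_dir2_cvg sZ sH sW.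
have sD : symm (dir1 Pp Z H).
  have j := Pplus_jet1 sZ sH; apply/esym/jet1_dir1.
  have := jet1_tr j; rewrite [(Pplus Z)^T]Pplus_symm//.
  apply: near_jet1; near=> t; apply: Pplus_symm; apply: symmD => //; exact: symmZ.
apply: (cvg_unique _ (trmx_cvg h)); first exact: norm_hausdorff.
apply: cvg_trans h; apply: near_eq_cvg; near=> t.
apply/esym/symmZ; apply: symmB; last exact: symmZ.
apply: symmB; last exact: Pplus_symm.
by apply: Pplus_symm; apply: symmD; [apply: symmD => //; exact: symmZ | exact: symmZ].
Unshelve. all: by end_near. Qed.

Lemma dir2_Pplus_firm Z H W W' : symm Z -> symm H -> symm W -> symm W' ->
  dotm (dir2 Pp Z H W - dir2 Pp Z H W') (dir2 Pp Z H W - dir2 Pp Z H W') <=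
  dotm (dir2 Pp Z H W - dir2 Pp Z H W') (W - W').
Proof.
move=> sZ sH sW sW'.
pose Q U t := (t ^+ 2 / 2)^-1 *:
  (Pplus (Z + t *: H + (t ^+ 2 / 2) *: U) - Pplus Z - t *: dir1 Pp Z H).
have hc : Q W t - Q W' t @[t --> 0^'+] --> dir2 Pp Z H W - dir2 Pp Z H W'.
  by apply: cvgB; exact: Pplus_dir2_cvg.
have hd : dotm (Q W t - Q W' t) (W - W') @[t --> 0^'+] -->
    dotm (dir2 Pp Z H W - dir2 Pp Z H W') (W - W').
  by apply: dotm_cvg => //; exact: cvg_cst.
apply: (ler_cvg_to (dotm_cvg hc hc) hd).
near=> t; have t0 : 0 < t by near: t; exact: nbhs_right_gt.
rewrite /Q -scalerBr.
set q := t ^+ 2 / 2; have q0 : 0 < q by rewrite divr_gt0// exprn_gt0.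
rewrite [X in q^-1 *: X](_ : _ = Pplus (Z + t *: H + q *: W) - Pplus (Z + t *: H + q *: W')); last first.
  move: (Pplus Z) (Pplus _) (Pplus _) (t *: dir1 _ _ _) => a b c d.
  by apply/matrixP=> i j; rewrite !mxE; ring.
have sX U : symm U -> symm (Z + t *: H + q *: U).
  by move=> sU; apply: symmD; [apply: symmD => //; exact: symmZ | exact: symmZ].
have := Pplus_firm (sX _ sW) (sX _ sW').
have -> : Z + t *: H + q *: W - (Z + t *: H + q *: W') = q *: (W - W').
  by rewrite opprD addrACA subrr add0r -scalerBr.
move: (Pplus _ - Pplus _) (W - W') => a b; rewrite dotmZr => hf.
rewrite !dotmZl dotmZr; apply: ler_wpM2l; first by rewrite invr_ge0 ltW.
by rewrite ler_pdivrMl.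
Unshelve. all: by end_near. Qed.

(** Two symmetric idempotents with the same fixed vectors absorb each other, [Q P = P] and
    [P Q = Q]; transposing one relation identifies them. *)
Lemma kerproj_unique Z P : P^T = P -> P *m P = P ->
  (forall x : 'cV[R]_n, Z *m x = 0 <-> P *m x = x) -> kerproj Z = P.
Proof.
move=> sP PP PZ.
have ex : exists P, [/\ P^T = P, P *m P = P &
  forall x : 'cV[R]_n, Z *m x = 0 <-> P *m x = x] by exists P.
have [sQ QQ QZ] := epsilon_spec (inhabits 0) _ ex.
rewrite -/(kerproj Z) in sQ QQ QZ; set Q := kerproj Z in sQ QQ QZ *.
have key A B : A *m A = A -> (forall x : 'cV[R]_n, A *m x = x -> B *m x = x) -> B *m A = A.
  move=> AA AB; apply/matrixP=> i j.
  have /matrixP/(_ i 0) : B *m col j A = col j A.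
    by apply: AB; rewrite colE mulmxA AA.
  by rewrite colE mulmxA -!colE !mxE.
have QP : Q *m P = P by apply: key => // x /PZ/QZ.
have PQ : P *m Q = Q by apply: key => // x /QZ/PZ.
by rewrite -PQ -[RHS]sP -[in RHS]QP trmx_mul sP sQ.
Qed.

(** Penrose's argument: symmetry of the products gives [Z B = Z C] and [B Z = C Z], whence
    [C = C Z C = B Z B = B]. *)
Lemma mp_pinv_unique Z B : Z *m B *m Z = Z -> B *m Z *m B = B ->
  (Z *m B)^T = Z *m B -> (B *m Z)^T = B *m Z -> mp_pinv Z = B.
Proof.
move=> b1 b2 b3 b4.
have ex : exists B, [/\ Z *m B *m Z = Z, B *m Z *m B = B,
  (Z *m B)^T = Z *m B & (B *m Z)^T = B *m Z] by exists B.
have [c1 c2 c3 c4] := epsilon_spec (inhabits 0) _ ex.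
rewrite -/(mp_pinv Z) in c1 c2 c3 c4; set C := mp_pinv Z in c1 c2 c3 c4 *.
have e1 : Z *m B = Z *m C.
  by rewrite -b3 -[in LHS]c1 -mulmxA trmx_mul c3 b3 !mulmxA b1.
have e2 : B *m Z = C *m Z.
  have h : B *m Z = (B *m Z) *m (C *m Z) by rewrite -mulmxA (mulmxA Z C) c1.
  transitivity ((B *m Z) *m (C *m Z))^T; first by rewrite -h b4.
  by rewrite trmx_mul b4 c4 -mulmxA (mulmxA Z B) b1.
by rewrite -c2 -mulmxA -e1 mulmxA -e2 b2.
Qed.

Lemma UpsilonE Z H V (l : 'rV[R]_n) (h := V^T *m H *m V) :
  V^T *m V = 1%:M -> V *m V^T = 1%:M -> Z = V *m diag_mx l *m V^T ->
  Upsilon Z H =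
  V *m (2%:R *: (sgE l 0 *m h *m diag_mx (\row_i (l 0 i)^-1) *m h *m sgE l 0)) *m V^T.
Proof.
move=> V1 V2 ZE; pose E0 := sgE l 0; pose L := diag_mx l.
pose Li := diag_mx (\row_i (l 0 i)^-1).
have VK (M N : 'M[R]_n) : V *m M *m V^T *m (V *m N *m V^T) = V *m (M *m N) *m V^T.
  by rewrite !mulmxA -(mulmxA _ V^T V) V1 mulmx1.
have Vt (M : 'M[R]_n) : (V *m M *m V^T)^T = V *m M^T *m V^T.
  by rewrite !trmx_mul trmxK mulmxA.
have E00 : E0 *m E0 = E0 by rewrite sgE_mul eqxx.
(* By the convention [0^-1 = 0], [Li *m L] is the projector onto the indices outside the kernel. *)
have LiE0 : 1%:M - Li *m L = E0.
  apply/matrixP=> i j; rewrite mul_diag_mx !mxE sgr_eq0.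
  case: (eqVneq i j) => [->|_]; last by rewrite !mulr0n mulr0 subrr.
  rewrite !mulr1n; case: (eqVneq (l 0 j) 0) => [->|lj]; first by rewrite mulr0 subr0.
  by rewrite mulVf// subrr.
have kE : kerproj Z = V *m E0 *m V^T.
  apply: kerproj_unique; first by rewrite Vt [E0^T]sgE_symm.
    by rewrite VK E00.
  move=> x; split=> [Zx|<-]; last by rewrite mulmxA ZE VK LE0 mulmx0 !mul0mx.
  rewrite -LiE0 mulmxBr mulmx1 mulmxBl V2 mulmxBl mul1mx.
  have -> : V *m (Li *m L) *m V^T = V *m Li *m V^T *m Z by rewrite ZE VK.
  by rewrite -(mulmxA _ Z) Zx mulmx0 subr0.
have LLi : Li *m L = L *m Li.
  by apply/matrixP=> i j; rewrite !mul_diag_mx !mxE; case: (eqVneq i j) => [->|_]; rewrite ?mulr1n ?mulr0n ?mulr0// mulrC.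
have sLL : (L *m Li)^T = L *m Li by rewrite trmx_mul !tr_diag_mx -LLi.
have pE : mp_pinv Z = V *m Li *m V^T.
  have d1 : L *m Li *m L = L.
    by rewrite -mulmxA -[Li *m L](subKr 1%:M) LiE0 mulmxBr mulmx1 LE0 subr0.
  have d2 : Li *m L *m Li = Li.
    apply/matrixP=> i j; rewrite mul_mx_diag mul_diag_mx !mxE.
    case: (eqVneq i j) => [->|_]; last by rewrite !mulr0n mulr0 mul0r.
    rewrite !mulr1n; case: (eqVneq (l 0 j) 0) => [->|lj]; first by rewrite invr0 mulr0.
    by rewrite mulVf// mul1r.
  by rewrite ZE; apply: mp_pinv_unique; rewrite !VK ?d1 ?d2// Vt ?LLi sLL.
rewrite /Upsilon kE pE -/E0 -/Li -scalemxAr -scalemxAl; congr (_ *: _).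
have -> : H = V *m h *m V^T by rewrite conjK.
by rewrite !VK.
Qed.

Lemma Upsilon_symm Z H : symm Z -> symm H -> symm (Upsilon Z H).
Proof.
move=> sZ sH; have [V [l [V1 V2 ZE]]] := symm_spectral sZ.
rewrite (UpsilonE _ V1 V2 ZE); apply/symm_sandwich/symmZ.
move: (symm_conj V sH); move: (V^T *m H *m V) => h sh.
rewrite /symm !trmx_mul [h^T]sh [(sgE l 0)^T]sgE_symm !tr_diag_mx.
by rewrite !mulmxA.
Qed.

Lemma Theta_scale Z H W a : symm Z -> symm H -> symm W -> 0 <= a ->
  Theta Z H (a *: W) = a *: Theta Z H W.
Proof.
move=> sZ sH sW; rewrite le_eqVlt => /predU1P[<-|a0].
  by rewrite !scale0r /Theta add0r subrr.
have sU := Upsilon_symm sZ sH; have [V [l [V1 V2 ZE]]] := symm_spectral sZ.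
have sh := symm_conj V sH.
have conjZ b (M : 'M[R]_n) : V *m (b *: M) *m V^T = b *: (V *m M *m V^T).
  by rewrite -scalemxAr -scalemxAl.
have key U : symm U -> Theta Z H U =
    V *m (2%:R *: (lin_part l (2^-1 *: (V^T *m U *m V)) +
      dir1 Pp (sgE l 0 *m (V^T *m H *m V) *m sgE l 0)
        (sgE l 0 *m (2^-1 *: (V^T *m U *m V)) *m sgE l 0))) *m V^T.
  move=> sUU; rewrite /Theta.
  rewrite (dir2E (Pplus_jet2 sH V1 V2 ZE (symmD sUU sU))).
  rewrite (dir2E (Pplus_jet2 sH V1 V2 ZE sU)).
  rewrite -scalerBr -mulmxBl -mulmxBr conjZ; congr (_ *: (_ *m _ *m _)).
  have uE : V^T *m Upsilon Z H *m V = 2%:R *: (sgE l 0 *m (V^T *m H *m V) *m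
      diag_mx (\row_i (l 0 i)^-1) *m (V^T *m H *m V) *m sgE l 0).
    rewrite (UpsilonE _ V1 V2 ZE); set u := 2%:R *: _.
    by rewrite !mulmxA V1 mul1mx -mulmxA V1 mulmx1.
  (* At [Upsilon] itself the kernel block of the correction is zero, where the derivative of [Pplus]
     vanishes; at [U + Upsilon] it is that of half the rotated [U] alone. The rest is linear, so the
     terms free of [U] cancel in the difference. *)
  have c0 := corr_upsilon l (V^T *m H *m V); rewrite -uE in c0.
  rewrite (mulmxDr V^T U) (mulmxDl (V^T *m U)) /diag_deriv2 corrD.
  set v := 2^-1 *: (V^T *m U *m V); set k := corr l _ _.
  rewrite lin_partD (mulmxDr (sgE l 0) v k) (mulmxDl (sgE l 0 *m v)) c0 addr0.
  rewrite dir1_Pplus0 addr0.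
  move: (lin_part l v) (lin_part l k) (dir1 _ _ _) => x y z.
  set u := (X in X + (x + y)); rewrite -/u; move: u => u.
  by apply/matrixP=> i j; rewrite !mxE; ring.
rewrite !key//; last exact: symmZ.
rewrite -conjZ; congr (_ *m _ *m _).
rewrite scalerA [a * _]mulrC -scalerA; congr (_ *: _).
set w := V^T *m W *m V; have sw : symm w := symm_conj V sW.
have sE0 g : symm g -> symm (sgE l 0 *m g *m sgE l 0).
  by move=> sg; rewrite -[X in _ *m X](sgE_symm l 0); exact: symm_sandwich.
have -> : 2^-1 *: (V^T *m (a *: W) *m V) = a *: (2^-1 *: w).
  by rewrite -scalemxAr -scalemxAl !scalerA mulrC.
have -> : sgE l 0 *m (a *: (2^-1 *: w)) *m sgE l 0 =
    a *: (sgE l 0 *m (2^-1 *: w) *m sgE l 0) by rewrite -scalemxAr -scalemxAl.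
rewrite lin_partZ [RHS]scalerDr; congr (_ + _).
apply: dir1_Pplus_scale => //; first exact: sE0.
exact/sE0/symmZ.
Qed.

End SymmetricData.

(** * Cocoercive iterations *)

Section ClosedSets.
Variables (R : realType) (n : nat).
Implicit Types (S K : set 'M[R]_n) (x y p q : 'M[R]_n).

Lemma dotm_tr x : dotm x^T x^T = dotm x x.
Proof. by rewrite /dotm trmxK mxtrace_mulC. Qed.

Lemma dotm_sub_sym x y : dotm (x - y) (x - y) = dotm (y - x) (y - x).
Proof. by rewrite -opprB dotmNl dotmNr opprK. Qed.

Lemma dotm_add_le x y : dotm (x + y) (x + y) <= 2 * dotm x x + 2 * dotm y y.
Proof.
have := dotm_ge0 (x - y); rewrite !dotm_expand (dotmC y x); lra.
Qed.

Lemma ball_dotm x y (e : R) : 0 < e -> dotm (x - y) (x - y) < e ^+ 2 -> ball x e y.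
Proof.
move=> e0 h; split=> // i j.
rewrite /ball /= -(@ltr_pXn2r _ 2)// ?nnegrE ?(ltW e0)//.
rewrite real_normK ?num_real//; apply: le_lt_trans h.
by have := entry_le_dotm (x - y) i j; rewrite !mxE.
Qed.

Lemma closure_dotmP S x :
  closure S x <-> forall e : R, 0 < e -> exists2 y, S y & dotm (x - y) (x - y) < e.
Proof.
split=> [Sx e e0|h B /nbhs_ballP[e /= e0 eB]].
  have c0 : x - y @[y --> x] --> x - x.
    exact: (@cvgB _ _ _ (nbhs x) _ (fun=> x) id x x (cvg_cst x) cvg_id).
  have c : dotm (x - y) (x - y) @[y --> x] --> dotm (x - x) (x - x).
    exact: (dotm_cvg c0 c0).
  rewrite subrr dotm0l in c.
  by have [y [Sy ye]] := Sx _ (cvgr_lt _ c _ e0); exists y.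
have [y Sy ye] := h _ (exprn_gt0 2 e0); exists y; split=> //.
by apply: eB; exact: ball_dotm.
Qed.

(** Replaces a passage [s -> 0]: for positive [a], the value [s = min(1, a / (2 c))] would give
    [s c <= a / 2 < a]. *)
Lemma small_multiple_le0 (a c : R) : (forall s, 0 < s -> s <= 1 -> a <= s * c) -> a <= 0.
Proof.
move=> h; rewrite leNgt; apply/negP => a0.
have c0 : 0 < c by have := h 1 ltr01 (lexx 1); rewrite mul1r; exact: lt_le_trans.
pose s := Num.min 1 (a / (2 * c)).
have s0 : 0 < s by rewrite lt_min ltr01 divr_gt0 ?mulr_gt0.
have s1 : s <= 1 by rewrite ge_min lexx.
have := h s s0 s1; have : s * c <= a / 2.
  apply: le_trans (_ : (a / (2 * c)) * c <= _).
    by rewrite ler_pM2r// ge_min lexx orbT.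
  by rewrite le_eqVlt; apply/orP; left; apply/eqP; field; rewrite gt_eqF.
by move=> h1 h2; lra.
Qed.

Lemma closure_polar S x p : (forall y, S y -> dotm x y <= 0) -> closure S p ->
  dotm x p <= 0.
Proof.
move=> h /closure_dotmP Sp; apply: (@small_multiple_le0 _ ((dotm x x + 1) / 2)) => s s0 s1.
(* Precision [s ^+ 2] makes Young's bound [(s |x|^2 + s) / 2], which is [s] times the chosen
   constant. *)
have [y /h hy ye] := Sp _ (exprn_gt0 2 s0).
have := dotm_young x (p - y) s0.
have : s^-1 * dotm (p - y) (p - y) <= s.
  by rewrite ler_pdivrMl// -expr2 ltW.
by rewrite dotmDr dotmNr; lra.
Qed.

Lemma closure_symm S p : (forall y, S y -> symm y) -> closure S p -> symm p.
Proof.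
move=> h /closure_dotmP Sp; apply/eqP; rewrite -subr_eq0; apply/eqP/dotm_eq0.
apply: (@small_multiple_le0 _ 4) => s s0 s1.
have [y /h hy ye] := Sp _ s0.
have -> : p^T - p = (p - y)^T + (y - p) by rewrite linearB /= [y^T]hy addrA subrK.
apply: le_trans (dotm_add_le _ _) _.
by rewrite dotm_tr (dotm_sub_sym y p); lra.
Qed.

(** The parallelogram identity makes a minimising sequence Cauchy; only midpoints of [K] enter
    it. *)
Lemma nearest_point_exists K (X : 'M[R]_n) : closed K -> K !=set0 ->
  (forall x y, K x -> K y -> K (2^-1 *: (x + y))) ->
  exists2 p, K p & forall q, K q -> dotm (X - p) (X - p) <= dotm (X - q) (X - q).
Proof.
move=> cK [z Kz] midK; pose D y := dotm (X - y) (X - y).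
pose E := [set D y | y in K]; pose d := inf E.
have E0 : has_inf E.
  split; first by exists (D z), z.
  by exists 0 => _ [y _ <-]; exact: dotm_ge0.
have dD y : K y -> d <= D y by move=> Ky; apply: ge_inf; [exact: E0.2 | exists y].
have ex k : exists y, K y /\ D y < d + k.+1%:R^-1.
  have k0 : 0 < k.+1%:R^-1 :> R by rewrite invr_gt0.
  by have [_ [y Ky <-] h] := inf_adherent k0 E0; exists y.
have [y yP] := boolp.choice ex.
have yy k N : (N <= k)%N -> dotm (y N - y k) (y N - y k) <= 4 * N.+1%:R^-1.
  move=> Nk; have [K1 h1] := yP N; have [K2 h2] := yP k.
  have := dD _ (midK _ _ K1 K2).
  have kN : k.+1%:R^-1 <= N.+1%:R^-1 :> R by rewrite lef_pV2 ?posrE// ler_nat ltnS.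
  have -> : D (2^-1 *: (y N + y k)) = 2^-1 * D (y N) + 2^-1 * D (y k) - 4^-1 * dotm (y N - y k) (y N - y k).
    rewrite /D; have -> : X - 2^-1 *: (y N + y k) = 2^-1 *: (X - y N) + 2^-1 *: (X - y k).
      by apply/matrixP=> i j; rewrite !mxE; field.
    have -> : y N - y k = (X - y k) - (X - y N) by apply/matrixP=> i j; rewrite !mxE; ring.
    move: (X - y N) (X - y k) => a b; rewrite !dotm_expand (dotmC b a); lra.
  move: (dotm (y N - y k) _) (D (y N)) (D (y k)) h1 h2 kN.
  by move: (k.+1%:R^-1) (N.+1%:R^-1) => ? ? ? ? ? ? ? ? ?; lra.
have cy : cvgn y.
  apply: cauchy_cvg; apply: cauchy_exP => e e0.
  have e2 : 0 < e ^+ 2 / 4 by rewrite divr_gt0// exprn_gt0.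
  have [N0 _ hN] := near_infty_natSinv_lt (PosNum e2).
  exists (y N0); exists N0 => // k /= Nk; apply: ball_dotm => //.
  apply: le_lt_trans (yy _ _ Nk) _.
  have : N0.+1%:R^-1 < e ^+ 2 / 4 := hN N0 (leqnn N0).
  by move: (N0.+1%:R^-1) (e ^+ 2) => ? ? ?; lra.
have [p yp] : exists p, y k @[k --> \oo] --> p by exists (lim (y @ \oo)).
exists p.
  by apply: (closed_cvg K cK _ _ yp); near=> k; exact: (yP k).1.
move=> q Kq; apply: le_trans (dD _ Kq).
have c1 : D (y k) @[k --> \oo] --> D p.
  by apply: dotm_cvg; apply: cvgB => //; exact: cvg_cst.
have c2 : d + harmonic k @[k --> \oo] --> d.
  by rewrite -[X in _ --> X]addr0; apply: cvgD; [exact: cvg_cst | exact: cvg_harmonic].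
by apply: (ler_cvg_to c1 c2); near=> k; exact: ltW (yP k).2.
Unshelve. all: by end_near. Qed.

End ClosedSets.

(** * Range and iteration of a homogeneous cocoercive map *)

Section CocoerciveIteration.
Variables (R : realType) (n : nat) (M : 'M[R]_n -> 'M[R]_n) (psi : 'M[R]_n).
Implicit Types x y z : 'M[R]_n.
Hypothesis psi_symm : symm psi.
Hypothesis M_symm : forall x, symm x -> symm (M x).
Hypothesis M_scale : forall a x, symm x -> 0 <= a -> M (a *: x) = a *: M x.
Hypothesis M_coco : forall x y, symm x -> symm y ->
  dotm (M x - M y) (M x - M y) <= dotm (M x - M y) (x - y).

Let K := closure [set M x | x in @Sn R n].
Let Ko := [set Y | Sn Y /\ forall x, Sn x -> inner (M x) Y <= 0].

Lemma M0 : M 0 = 0.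
Proof. by rewrite -(scale0r (0 : 'M[R]_n)) M_scale ?scale0r//; exact: symm0. Qed.

(** [x - M x] is firmly nonexpansive along with [M]. The subtracted term is the gain that later
    forces the steps of two orbits together. *)
Lemma M_contract x y : symm x -> symm y ->
  dotm ((x - M x) - (y - M y)) ((x - M x) - (y - M y)) <=
  dotm (x - y) (x - y) - dotm (M x - M y) (M x - M y).
Proof.
move=> sx sy; have := M_coco sx sy.
have -> : (x - M x) - (y - M y) = (x - y) - (M x - M y).
  by apply/matrixP=> i j; rewrite !mxE; ring.
move: (M x - M y) (x - y) => a b; rewrite !dotm_expand (dotmC b a); lra.
Qed.

(** A solution of [s x + M x = y] is a fixed point of [T], a contraction of ratio [1 / (1 + s)]
    because [x - M x] is nonexpansive. An iterate started at 0 is an approximate solution, which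
    suffices. *)
Lemma resolvent_approx (s : R) y (e : R) : 0 < s -> symm y -> 0 < e ->
  exists2 x, symm x & dotm (s *: x + M x - y) (s *: x + M x - y) < e.
Proof.
move=> s0 sy e0; pose q := (1 + s)^-1.
have q1 : 0 < 1 + s by lra.
have q0 : 0 < q by rewrite invr_gt0.
pose T x := q *: (x - M x + y).
have sT x : symm x -> symm (T x).
  by move=> sx; apply: symmZ; apply: symmD => //; apply: symmB => //; exact: M_symm.
have Tc x z : symm x -> symm z ->
    dotm (T x - T z) (T x - T z) <= q ^+ 2 * dotm (x - z) (x - z).
  move=> sx sz; rewrite /T -scalerBr opprD addrACA subrr addr0 dotmZl dotmZr mulrA -expr2.
  rewrite ler_pM2l ?exprn_gt0//; apply: le_trans (M_contract sx sz) _.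
  by rewrite gerDl oppr_le0 dotm_ge0.
pose x k := iter k T 0.
have sx k : symm (x k) by elim: k => [|k IH]; [exact: symm0 | exact: sT].
pose r k := dotm (x k - T (x k)) (x k - T (x k)).
have rk k : r k <= (q ^+ 2) ^+ k * r 0%N.
  elim: k => [|k IH]; first by rewrite expr0 mul1r.
  rewrite exprS -mulrA; apply: le_trans (Tc _ _ (sx k) (sT _ (sx k))) _.
  by rewrite ler_pM2l ?exprn_gt0.
have q2 : `|q ^+ 2| < 1.
  rewrite ger0_norm ?sqr_ge0// expr_lt1// ?ltW//.
  by rewrite invf_lt1//; lra.
have c : (1 + s) ^+ 2 * ((q ^+ 2) ^+ k * r 0%N) @[k --> \oo] --> (0 : R).
  rewrite -[X in _ --> X](mulr0 ((1 + s) ^+ 2)); apply: cvgM; first exact: cvg_cst.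
  rewrite -[X in _ --> X](mul0r (r 0%N)); apply: cvgM; last exact: cvg_cst.
  exact: cvg_expr.
have [N _ hN] := cvgr_lt _ c _ e0.
exists (x N) => //; apply: le_lt_trans (hN N (leqnn N)).
have -> : s *: x N + M (x N) - y = (1 + s) *: (x N - T (x N)).
  rewrite scalerBr /T scalerA mulfV ?gt_eqF// scale1r.
  by apply/matrixP=> i j; rewrite !mxE; ring.
by rewrite dotmZl dotmZr mulrA -expr2 ler_pM2l ?exprn_gt0//; exact: rk.
Qed.

(* The resolvent [x] of the monotone map [M] with [s x + M x = M a + M b] has
   [s |x|^2] bounded as [s] tends to 0, whence [M x] tends to [M a + M b]. *)
Lemma range_add a b : symm a -> symm b -> K (M a + M b).
Proof.
move=> sa sb; apply/closure_dotmP => e e0.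
have [y yE] : exists y, y = M a + M b by exists (M a + M b).
have [z zE] : exists z, z = a + b by exists (a + b).
have sy : symm y by rewrite yE; apply: symmD; exact: M_symm.
pose c := 2 * (dotm (M a) a + dotm (M b) b).
pose C := `|3 + 3 * dotm z z - 2 * dotm y z + 2 * c|.
have C0 : 0 <= C by exact: normr_ge0.
have C1 : 3 + 3 * dotm z z - 2 * dotm y z + 2 * c <= C by exact: ler_norm.
pose s := Num.min 1 (e / (4 * (C + 1))).
have s0 : 0 < s by rewrite lt_min ltr01 divr_gt0// mulr_gt0//; lra.
have s1 : s <= 1 by rewrite ge_min lexx.
have sC : 2 * s * (C + 1) < e.
  have : s <= e / (4 * (C + 1)) by rewrite ge_min lexx orbT.
  rewrite ler_pdivlMr; last by lra.
  by move=> h; lra.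
have [x sx hx] := resolvent_approx s0 sy (exprn_gt0 2 s0).
have [w wE] : exists w, w = s *: x + M x - y by exists (s *: x + M x - y).
rewrite -wE in hx.
have Mx : M x = y - s *: x + w by rewrite wE; apply/matrixP=> i j; rewrite !mxE; ring.
have mono u v : symm u -> symm v -> 0 <= dotm (M u - M v) (u - v).
  by move=> su sv; apply: le_trans (M_coco su sv); exact: dotm_ge0.
(* Monotonicity is tested against [2 a] and [2 b] and averaged. As [M (2 a) = 2 M a], the products
   with [x] combine to [<M x - y, x>], which is [- s |x|^2] up to the residual [w]; testing against
   [a] and [b] would leave an uncontrolled [<y, x>]. *)
have h1 : 0 <= dotm (M x) x - dotm y x - dotm (M x) z + c.
  have two0 : 0 <= 2 :> R by [].
  have := mono _ _ sx (symmZ 2 sa); have := mono _ _ sx (symmZ 2 sb).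
  rewrite !M_scale// /c yE zE !dotm_expand; lra.
(* The residual has [|w|^2 < s^2], so [<w, x>] costs at most [s |x|^2 / 4 + s]; another quarter of
   [s |x|^2] absorbs [s <x, z>]. *)
have h2 : 2 * dotm w x <= 2 / s * dotm w w + s / 2 * dotm x x.
  by have := dotm_young w x (divr_gt0 (ltr0Sn R 1) s0); rewrite invf_div.
have h3 : 2 / s * dotm w w <= 2 * s.
  by rewrite mulrAC ler_pdivrMr// -mulrA -expr2; lra.
have h4 : 2 * dotm x z <= 2^-1 * dotm x x + 2 * dotm z z.
  by have := @dotm_young _ _ 2^-1 x z; rewrite invrK; apply; rewrite invr_gt0.
have h5 : - (2 * dotm w z) <= dotm w w + dotm z z.
  by have := dotm_ge0 (w + z); rewrite !dotm_expand (dotmC z w); lra.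
have h6 : s * (2 * dotm x z) <= s * (2^-1 * dotm x x + 2 * dotm z z) by rewrite ler_pM2l.
have sz : s * dotm z z <= dotm z z by rewrite ler_piMl// dotm_ge0.
have ss : s ^+ 2 <= s by rewrite expr2 ler_piMl// ltW.
have h7 : s * dotm x x <= C.
  move: h1; rewrite Mx !dotm_expand; lra.
exists (M x); first by exists x.
have -> : M a + M b - M x = s *: x + - w by rewrite -yE Mx; apply/matrixP=> i j; rewrite !mxE; ring.
apply: le_lt_trans (dotm_add_le _ _) _.
rewrite dotmNl dotmNr opprK dotmZl dotmZr.
have : s * (s * dotm x x) <= s * C by rewrite ler_pM2l.
by lra.
Qed.

Lemma K_add x y : K x -> K y -> K (x + y).
Proof.
move=> /closure_dotmP hx /closure_dotmP hy; apply/closure_dotmP => e e0.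
have e8 : 0 < e / 16 by lra.
have [_ [a sa <-] ha] := hx _ e8; have [_ [b sb <-] hb] := hy _ e8.
have /closure_dotmP/(_ _ e8)[z Sz hz] := range_add sa sb.
exists z => //.
have -> : x + y - z = ((x - M a) + (y - M b)) + (M a + M b - z).
  by apply/matrixP=> i j; rewrite !mxE; ring.
have h1 := dotm_add_le (x - M a + (y - M b)) (M a + M b - z).
have h2 := dotm_add_le (x - M a) (y - M b).
by lra.
Qed.

Lemma K_scale a x : 0 <= a -> K x -> K (a *: x).
Proof.
move=> a0 /closure_dotmP hx; apply/closure_dotmP => e e0.
have a2 : 0 < a ^+ 2 + 1 by have := sqr_ge0 a; lra.
have [_ [z sz <-] hz] := hx _ (divr_gt0 e0 a2).
exists (a *: M z); first by exists (a *: z); [exact: symmZ | rewrite M_scale].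
rewrite -scalerBr dotmZl dotmZr mulrA -expr2.
move: hz; rewrite ltr_pdivlMr// => hz; have := dotm_ge0 (x - M z); lra.
Qed.

Lemma K_symm x : K x -> symm x.
Proof. by apply: closure_symm => _ [z sz <-]; exact: M_symm. Qed.

Lemma K_range x : symm x -> K (M x).
Proof. by move=> sx; apply: subset_closure; exists x. Qed.

Lemma K_closed : closed K.
Proof. exact: closed_closure. Qed.

Lemma K_cone : convex_cone K.
Proof.
split; [|exact: K_add|exact: K_scale].
by rewrite -M0; apply: K_range; exact: symm0.
Qed.

Lemma Ko_cone : convex_cone Ko.
Proof.
split.
- split; first exact: symm0.
  by move=> x sx; rewrite /inner mulmx0 mxtrace0.
- move=> x y [sx hx] [sy hy]; split; first exact: symmD.
  move=> z sz; move: (hx _ sz) (hy _ sz); rewrite !(innerE _ (M_symm sz)) dotmDr; lra.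
move=> a x a0 [sx hx]; split; first exact: symmZ.
move=> z sz; move: (hx _ sz); rewrite !(innerE _ (M_symm sz)) dotmZr.
exact: mulr_ge0_le0.
Qed.

Lemma Ko_closed : closed Ko.
Proof.
move=> p cp; split; first by apply: closure_symm cp => y [].
move=> x sx; rewrite innerE; last exact: M_symm.
apply: closure_polar cp => y [_ /(_ _ sx)].
by rewrite innerE//; exact: M_symm.
Qed.

(** The nearest point [p] is compared with [p + s q] and [(1 - s) p], both in the cone; small [s]
    yields the polar inequality and the orthogonality. *)
Lemma K_projection : exists p, [/\ K p, dotm (psi - p) p = 0 &
  forall q, K q -> dotm (psi - p) q <= 0].
Proof.
have [K0 KD KZ] := K_cone.
have [p Kp hp] : exists2 p, K p & forall q, K q -> dotm (psi - p) (psi - p) <= dotm (psi - q) (psi - q).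
  apply: nearest_point_exists; [exact: K_closed | by exists 0 |].
  by move=> x y Kx Ky; apply: KZ; [rewrite invr_ge0 | exact: KD].
have polar q : K q -> dotm (psi - p) q <= 0.
  move=> Kq; apply: (@small_multiple_le0 _ _ (dotm q q / 2)) => s s0 s1.
  have := hp _ (KD _ _ Kp (KZ _ _ (ltW s0) Kq)).
  rewrite opprD addrA; move: (psi - p) => u; rewrite !dotm_expand (dotmC q u) => h.
  rewrite -(ler_pM2l s0); lra.
exists p; split=> //; apply/eqP; rewrite eq_le polar//= -oppr_le0.
apply: (@small_multiple_le0 _ _ (dotm p p / 2)) => s s0 s1.
have s1' : 0 <= 1 - s by lra.
have := hp _ (KZ _ _ s1' Kp).
have -> : psi - (1 - s) *: p = (psi - p) + s *: p.
  by apply/matrixP=> i j; rewrite !mxE; ring.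
move: (psi - p) => u; rewrite !dotm_expand (dotmC p u) => h.
rewrite -(ler_pM2l s0); lra.
Qed.

Lemma cocoercive_iteration (W : nat -> 'M[R]_n) : symm (W 0%N) ->
  (forall k, W k.+1 = W k - M (W k) + psi) ->
  [/\ (fun k => W k.+1 - W k) @ \oo --> psi - mproj K psi
    & psi - mproj K psi = mproj Ko psi].
Proof.
move=> sW0 WS; have [p [Kp pp polar]] := K_projection.
have KE : mproj K psi = p.
  by apply: mproj_unique => // q /polar h; rewrite dotmDr dotmNr pp; lra.
have sp := K_symm Kp.
have KoE : mproj Ko psi = psi - p.
  apply: mproj_unique.
    split; first exact: symmB.
    move=> x sx; rewrite innerE; last exact: M_symm.
    by rewrite dotmC; apply: polar; exact: K_range.
  (* The inequality on values of [M] that defines [Ko] extends to the limit point [p]. *)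
  move=> q [sq hq]; have : dotm q p <= 0.
    apply: closure_polar Kp => _ [x sx <-].
    by rewrite dotmC -innerE ?hq//; exact: M_symm.
  have -> : psi - (psi - p) = p by rewrite opprB addrC subrK.
  rewrite (dotmC p) dotmDl dotmNl pp; lra.
rewrite KE KoE; split=> //.
pose G x := x - M x + psi.
have sG x : symm x -> symm (G x).
  by move=> sx; apply: symmD => //; apply: symmB => //; exact: M_symm.
have GG x y : symm x -> symm y -> dotm (G x - G y) (G x - G y) <=
    dotm (x - y) (x - y) - dotm (M x - M y) (M x - M y).
  by move=> sx sy; rewrite /G opprD addrACA subrr addr0; exact: M_contract.
(* [A x] is the step of [G] at [x] with the sign reversed, and [v] is the shortest element of
   [K - psi]. *)
pose A x := M x - psi; pose v := p - psi.
have AG x : A x = x - G x by rewrite /A /G; apply/matrixP=> i j; rewrite !mxE; ring.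
(* Since [<v, M x - p> >= 0], a step almost as short as [v] is close to [v]. *)
have Av x : symm x -> dotm (A x - v) (A x - v) <= dotm (A x) (A x) - dotm v v.
  move=> sx; have := polar _ (K_range sx).
  have -> : psi - p = - v by rewrite /v opprB.
  have -> : A x - v = M x - p by rewrite /A /v; apply/matrixP=> i j; rewrite !mxE; ring.
  have -> : A x = v + (M x - p) by rewrite /A /v; apply/matrixP=> i j; rewrite !mxE; ring.
  have pv : dotm v p = 0 by rewrite /v -opprB dotmNl pp oppr0.
  move: pv; move: v (M x) => u m pv; rewrite !dotm_expand (dotmC m u) (dotmC p u) (dotmC p m) pv; lra.
have sW k : symm (W k) by elim: k => [//|k IH]; rewrite WS; exact: sG.
have key : forall e, 0 < e -> \forall k \near \oo, dotm (A (W k) - v) (A (W k) - v) < e.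
  (* The constant comes from [|A z0|^2 - |v|^2 <= s |v|^2 + s + s^2 <= s C] when [|M z0 - p| < s];
     then [s C <= e / 4]. *)
  move=> e e0; pose C := 2 + dotm v v; have C0 : 0 < C by have := dotm_ge0 v; rewrite /C; lra.
  pose s := Num.min 1 (e / (4 * C)).
  have s0 : 0 < s by rewrite lt_min ltr01 divr_gt0// mulr_gt0.
  have s1 : s <= 1 by rewrite ge_min lexx.
  have sC : 4 * (s * C) <= e.
    have : s <= e / (4 * C) by rewrite ge_min lexx orbT.
    by rewrite ler_pdivlMr ?mulr_gt0// => h; lra.
  have /closure_dotmP/(_ _ (exprn_gt0 2 s0))[_ [z0 sz0 <-] hz0] := Kp.
  pose z k := iter k G z0.
  have sz k : symm (z k) by elim: k => [//|k IH]; exact: sG.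
  have Az k : dotm (A (z k)) (A (z k)) <= dotm (A z0) (A z0).
    elim: k => [//|k IH]; apply: le_trans IH.
    rewrite !AG -/(G (z k)) /=; apply: le_trans (GG _ _ (sz k) (sG _ (sz k))) _.
    by rewrite gerDl oppr_le0 dotm_ge0.
  have Azv k : dotm (A (z k) - v) (A (z k) - v) <= s * C.
    apply: le_trans (Av _ (sz k)) _; apply: le_trans (lerB (Az k) (lexx _)) _.
    have hA : dotm (A z0 - v) (A z0 - v) < s ^+ 2.
      have -> : A z0 - v = M z0 - p by rewrite /A /v; apply/matrixP=> i j; rewrite !mxE; ring.
      by rewrite dotm_sub_sym.
    have h := dotm_young v (A z0 - v) s0.
    have h' : s^-1 * dotm (A z0 - v) (A z0 - v) <= s by rewrite ler_pdivrMl// -expr2 ltW.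
    have ss : s ^+ 2 <= s by rewrite expr2 ler_piMl// ltW.
    have : dotm (A z0) (A z0) = dotm v v + 2 * dotm v (A z0 - v) + dotm (A z0 - v) (A z0 - v).
      by move: (A z0) (v) => a u; rewrite !dotm_expand (dotmC a u); ring.
    by rewrite /C; lra.
  (* The squared distance of the orbits drops by at least the squared difference of their steps.
     Being nonincreasing and bounded below it converges, so that difference tends to 0. *)
  pose r k := dotm (W k - z k) (W k - z k).
  have rS k : r k.+1 <= r k - dotm (A (W k) - A (z k)) (A (W k) - A (z k)).
    have -> : A (W k) - A (z k) = M (W k) - M (z k) by rewrite /A opprB addrA subrK.
    rewrite /r WS; exact: GG.
  have cr : cvgn r.
    apply: nonincreasing_is_cvgn; last by exists 0 => _ [k _ <-]; exact: dotm_ge0.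
    apply/nonincreasing_seqP => k; apply: le_trans (rS k) _.
    by rewrite gerDl oppr_le0 dotm_ge0.
  have [l rl] : exists l : R, r k @[k --> \oo] --> l by exists (limn r).
  have rl' : r k.+1 @[k --> \oo] --> l by rewrite (cvg_shiftS r).
  have c : r k - r k.+1 @[k --> \oo] --> (0 : R) by rewrite -(subrr l); exact: cvgB.
  have e4 : 0 < e / 4 by lra.
  apply: filterS (cvgr_lt _ c _ e4) => k hk.
  have -> : A (W k) - v = (A (W k) - A (z k)) + (A (z k) - v) by rewrite addrA subrK.
  apply: le_lt_trans (dotm_add_le _ _) _.
  by have := rS k; have := Azv k; lra.
have c0 : dotm (A (W k) - v) (A (W k) - v) @[k --> \oo] --> (0 : R).
  apply/cvgr0Pnorm_lt => e e0; apply: filterS (key e e0) => k.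
  by rewrite ger0_norm// dotm_ge0.
have c1 : A (W k) - v @[k --> \oo] --> (0 : 'M[R]_n).
  by apply: (dotm_cvg0 _ c0); near=> k.
have -> : (fun k => W k.+1 - W k) = (fun k => (psi - p) - (A (W k) - v)).
  by apply/funext => k; rewrite WS /A /v; apply/matrixP=> i j; rewrite !mxE; ring.
rewrite -[X in _ --> X]subr0; apply: cvgB => //; exact: cvg_cst.
Unshelve. all: by end_near. Qed.

End CocoerciveIteration.

(** * The affine constraint and the theorem *)

Section AffineProjection.
Variables (R : realType) (n m : nat) (Ai : 'I_m -> 'M[R]_n).
Hypothesis sAi : forall i, symm (Ai i).
Hypothesis surj : surjA Ai.
Implicit Types (X Y : 'M[R]_n) (y : 'cV[R]_m).

Let G := gramA Ai.

Lemma dotm_opAadj y X : dotm (opAadj Ai y) X = (y^T *m opA Ai X) 0 0.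
Proof.
rewrite dotmC /opAadj mxE.
rewrite (big_morph (dotm X) (dotmDr X) (dotm0r X)); apply: eq_bigr => i _.
by rewrite dotmZr !mxE (innerE _ (sAi i)) dotmC.
Qed.

Lemma opA_opAadj y : opA Ai (opAadj Ai y) = G *m y.
Proof.
apply/colP => i; rewrite !mxE (innerE _ (sAi i)) /opAadj.
rewrite (big_morph (dotm (Ai i)) (dotmDr (Ai i)) (dotm0r (Ai i))).
by apply: eq_bigr => j _; rewrite dotmZr !mxE (innerE _ (sAi i)) mulrC.
Qed.

Lemma gramA_tr : G^T = G.
Proof. by apply/matrixP=> i j; rewrite !mxE !(innerE _ (sAi _)) dotmC. Qed.

(** A kernel vector [v] has [|opAadj v|^2 = 0]; with [v = opA X] by surjectivity,
    [|v|^2 = <opAadj v, X> = 0]. *)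
Lemma gramA_unit : G \in unitmx.
Proof.
rewrite -row_free_unit; apply: inj_row_free => v vG.
have Gv : G *m v^T = 0 by rewrite -[G]gramA_tr -trmx_mul vG trmx0.
have av : opAadj Ai v^T = 0.
  by apply/dotm_eq0; rewrite dotm_opAadj opA_opAadj Gv mulmx0 mxE.
have [X _ Xv] := surj v^T.
have := dotm_opAadj v^T X; rewrite av dotm0l Xv trmxK => v0.
apply/rowP => i; rewrite [RHS]mxE; apply/eqP; rewrite -sqrf_eq0 eq_le sqr_ge0 andbT v0.
rewrite mxE (bigD1 i)//= mxE -expr2 lerDl; apply: sumr_ge0 => j _.
by rewrite mxE -expr2 sqr_ge0.
Qed.

Lemma opAD X Y : opA Ai (X + Y) = opA Ai X + opA Ai Y.
Proof. by apply/colP => i; rewrite !mxE !(innerE _ (sAi i)) dotmDr. Qed.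
Lemma opAZ a X : opA Ai (a *: X) = a *: opA Ai X.
Proof. by apply/colP => i; rewrite !mxE !(innerE _ (sAi i)) dotmZr. Qed.
Lemma opAadjD y y' : opAadj Ai (y + y') = opAadj Ai y + opAadj Ai y'.
Proof. by rewrite -big_split; apply: eq_bigr => i _; rewrite mxE scalerDl. Qed.
Lemma opAadjZ a y : opAadj Ai (a *: y) = a *: opAadj Ai y.
Proof. by rewrite scaler_sumr; apply: eq_bigr => i _; rewrite mxE scalerA. Qed.

Lemma projPD X Y : projP Ai (X + Y) = projP Ai X + projP Ai Y.
Proof. by rewrite /projP opAD mulmxDr opAadjD. Qed.
Lemma projPZ a X : projP Ai (a *: X) = a *: projP Ai X.
Proof. by rewrite /projP opAZ -scalemxAr opAadjZ. Qed.
Lemma projPN X : projP Ai (- X) = - projP Ai X.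
Proof. by rewrite -scaleN1r projPZ scaleN1r. Qed.
Lemma projPB X Y : projP Ai (X - Y) = projP Ai X - projP Ai Y.
Proof. by rewrite projPD projPN. Qed.

Lemma projP_symm X : symm (projP Ai X).
Proof.
rewrite /projP /opAadj /symm linear_sum /=; apply: eq_bigr => i _.
by rewrite linearZ /= [(Ai i)^T]sAi.
Qed.

Lemma projP_adj X Y : dotm (projP Ai X) Y = dotm X (projP Ai Y).
Proof.
rewrite (dotmC X) !dotm_opAadj.
rewrite !trmx_mul trmx_inv gramA_tr.
set u := opA Ai X; set v := opA Ai Y.
have -> : u^T *m invmx G *m v = (v^T *m invmx G *m u)^T.
  by rewrite !trmx_mul trmxK trmx_inv gramA_tr mulmxA.
by rewrite mxE.
Qed.

Lemma projP_idem X : projP Ai (projP Ai X) = projP Ai X.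
Proof. by rewrite {1}/projP {1}/projP opA_opAadj mulKmx//; exact: gramA_unit. Qed.

Lemma dotm_projP X Y : dotm (projP Ai X) Y = dotm (projP Ai X) (projP Ai Y).
Proof. by rewrite -[RHS]projP_adj projP_idem. Qed.

(** With [u = P X + P^perp Y], the rest [X + Y - u] is [P^perp X + P Y], and orthogonality of the
    two projectors leaves [<P X, P Y> + <P^perp X, P^perp Y>]. Applied to increments of [Theta] and
    [Thetaperp], this turns firm nonexpansiveness into cocoercivity. *)
Lemma complementary_coco X Y :
  dotm (projP Ai X + projPperp Ai Y) (X + Y) -
  dotm (projP Ai X + projPperp Ai Y) (projP Ai X + projPperp Ai Y) = dotm X Y.
Proof.
rewrite /projPperp.
have h1 := dotm_projP X X; have h2 := dotm_projP X Y; have h3 := dotm_projP Y Y.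
have h4 := dotm_projP Y X.
move: (projP Ai X) (projP Ai Y) h1 h2 h3 h4 => p q.
rewrite !dotm_expand (dotmC q p) (dotmC Y p) (dotmC Y q) (dotmC Y X).
lra.
Qed.

(** Here and in the next two lemmas [T] stands for a value of [Theta] and [X - T] for that of
    [Thetaperp]. *)
Lemma split_sub T T' X X' :
  projP Ai T + projPperp Ai (X - T) - (projP Ai T' + projPperp Ai (X' - T')) =
  projP Ai (T - T') + projPperp Ai (X - X' - (T - T')).
Proof.
rewrite /projPperp !projPB.
move: (projP Ai T) (projP Ai T') (projP Ai X) (projP Ai X') => p p' q q'.
by apply/matrixP=> i j; rewrite !mxE; ring.
Qed.

Lemma split_scale a T X :
  projP Ai (a *: T) + projPperp Ai (a *: X - a *: T) =
  a *: (projP Ai T + projPperp Ai (X - T)).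
Proof. by rewrite -scalerBr /projPperp !projPZ -scalerBr -scalerDr. Qed.

Lemma split_swap T X :
  projPperp Ai T + projP Ai (X - T) = X - (projP Ai T + projPperp Ai (X - T)).
Proof.
rewrite /projPperp !projPB; move: (projP Ai T) (projP Ai X) => p q.
by apply/matrixP=> i j; rewrite !mxE; ring.
Qed.

End AffineProjection.

Theorem theorem4p8 (R : realType) (n m : nat) (C : 'M[R]_n)
    (Ai : 'I_m -> 'M[R]_n) (b : 'cV[R]_m) (sigma : R)
    (Zb Hb : 'M[R]_n) (W : nat -> 'M[R]_n) :
  symm C -> (forall i, symm (Ai i)) -> 0 < sigma ->
  surjA Ai ->
  strict_compl Ai C b ->
  Zstar Ai C b sigma Zb ->
  critcone Ai Zb Hb ->
  symm (W 0%N) ->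
  (forall k, W k.+1 = iter_step Ai Zb Hb (W k)) ->
  let Ps := Psi Ai Zb Hb in
  let K := Kcone Ai Zb Hb in
  let Ko := Kpolar Ai Zb Hb in
  [/\ closed K /\ convex_cone K, closed Ko /\ convex_cone Ko,
      (fun k => W k.+1 - W k) @ \oo --> Ps - mproj K Ps
    & Ps - mproj K Ps = mproj Ko Ps].
Proof.
move=> _ sAi _ surj _ [X [S [[yX [SX [_ _ [sX _] _ _]]] [XS [yS [_ _ _ [sS _] _]]] ZE]]].
move=> [sH _] sW0 WS Ps K Ko.
have sZ : symm Zb by rewrite ZE; apply: symmB => //; exact: symmZ.
have sU := Upsilon_symm sZ sH.
have sq Y : symm Y -> symm (projPperp Ai Y).
  by move=> sY; apply: symmB => //; exact: projP_symm.
have sT V : symm V -> symm (Theta Zb Hb V).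
  by move=> sV; apply: symmB; apply: dir2_Pplus_symm => //; exact: symmD.
(* [Pminus] is the identity minus [Pplus]; this passes to second derivatives, and [Upsilon]
   cancels. *)
have Tp V : symm V -> Thetaperp Zb Hb V = V - Theta Zb Hb V.
  move=> sV; rewrite /Thetaperp /Theta !dir2_Pminus//; last exact: symmD.
  move: (Upsilon _ _) (dir2 _ _ _ (Upsilon _ _)) (dir2 _ _ _ (V + _)) => x y z.
  by apply/matrixP=> i j; rewrite !mxE; ring.
pose M := Kmap Ai Zb Hb.
have ME V : symm V -> M V = projP Ai (Theta Zb Hb V) + projPperp Ai (V - Theta Zb Hb V).
  by move=> sV; rewrite /M /Kmap Tp.
have M_symm V : symm V -> symm (M V).
  move=> sV; rewrite ME//; apply: symmD; first exact: projP_symm.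
  by apply/sq/symmB => //; exact: sT.
have M_scale a V : symm V -> 0 <= a -> M (a *: V) = a *: M V.
  move=> sV a0; rewrite !ME//; last exact: symmZ.
  by rewrite Theta_scale// (split_scale sAi).
have M_coco V V' : symm V -> symm V' ->
    dotm (M V - M V') (M V - M V') <= dotm (M V - M V') (V - V').
  move=> sV sV'; rewrite !ME//.
  set d := Theta Zb Hb V - Theta Zb Hb V'; set d' := (V - V') - d.
  (* [d'] is the increment of [Thetaperp], and firm nonexpansiveness of [Theta] says that its
     product with [d] is nonnegative. *)
  have firm : 0 <= dotm d d'.
    have h := dir2_Pplus_firm sZ sH (symmD sV sU) (symmD sV' sU).
    have e1 : dir2 (@Pplus R n) Zb Hb (V + Upsilon Zb Hb) -
        dir2 (@Pplus R n) Zb Hb (V' + Upsilon Zb Hb) = d.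
      rewrite /d /Theta.
      move: (dir2 _ _ _ (Upsilon _ _)) (dir2 _ _ _ (V' + _)) (dir2 _ _ _ (V + _)) => x y z.
      by apply/matrixP=> i j; rewrite !mxE; ring.
    have e2 : V + Upsilon Zb Hb - (V' + Upsilon Zb Hb) = V - V'.
      by rewrite opprD addrACA subrr addr0.
    by rewrite e1 e2 in h; rewrite /d' dotmDr dotmNr subr_ge0.
  rewrite (split_sub sAi) -/d -/d'.
  have := complementary_coco sAi surj d d'.
  have -> : d + d' = V - V' by rewrite /d' addrC subrK.
  lra.
have sPs : symm Ps.
  apply: symmB; first by apply/symmN/projP_symm.
  apply: sq; rewrite dir2_Pminus//; apply: symmB => //.
  exact: dir2_Pplus_symm.
have WM k : symm (W k) -> W k.+1 = W k - M (W k) + Ps.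
  by move=> sW; rewrite WS /iter_step ME// Tp// (split_swap sAi).
have sW k : symm (W k).
  elim: k => [//|k IH]; rewrite WM//; apply: symmD => //; apply: symmB => //.
  exact: M_symm.
have [lim_W proj_eq] := cocoercive_iteration sPs M_symm M_scale M_coco sW0 (fun k => WM k (sW k)).
split; [split|split|exact: lim_W|exact: proj_eq].
- exact: K_closed.
- exact: K_cone M_symm M_scale M_coco.
- exact: Ko_closed.
- exact: Ko_cone.
Qed.
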